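(* Let $A\in\mathbb{R}^{m\times n}$, $b\in\mathbb{R}^m$, let $g^*:\mathbb{R}^m\to\mathbb{R}$ be strongly convex with a Lipschitz-continuous gradient, and let $f:\mathbb{R}^n\to\mathbb{R}$ be strongly convex. Let $(z_k^* )_{k\ge 0}$, $(x_k)_{k\ge 0}$ be the random iterates of the Generalized Extended Randomized Block Kaczmarz (GERK) method described in the context. Then the iterates $z_k^*$ converge in expectation to $b-\hat{y}$, where $\hat{y}\in\mathcal{R}(A)$ is the unique solution of $$\min_{y\in\mathbb{R}^m} g^*(b-y)\quad\text{s.t.}\quad y\in\mathcal{R}(A).$$ If the subdifferential mapping of $f$ grows at most linearly, then the iterates $x_k$ converge in expectation to the corresponding unique solution $\hat{x}$ of $$\min_{x\in\mathbb{R}^n} f(x)\quad\text{s.t.}\quad Ax=\hat{y}.$$ More precisely, for some $q\in(0,1)$ and $c>0$ (independent of $k$) the expected rates of convergence are $$\mathbb{E}\left[\|z_k^*-(b-\hat{y})\|_2^2\right]\le c\cdot q^k \quad\text{for all } k\ge 0,$$ and (when the subdifferential mapping of $f$ grows at most linearly) $$\mathbb{E}\left[\|x_k-\hat{x}\|_2^2\right]\le \frac{c}{k}\quad\text{for all } k\ge 1.$$ Moreover, if in addition a global error bound holds at $\hat{x}$, i.e. there is $\gamma>0$ such that $D_f^{x^*}(x,\hat{x})\le\gamma\cdot\|Ax-\hat{y}\|_2^2$ for all $x\in\mathbb{R}^n$ and all $x^*\in\partial f(x)\cap\mathcal{R}(A^T)$, then even $$\mathbb{E}\left[\|x_k-\hat{x}\|_2^2\right]\le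 c\cdot(1+k)\cdot q^k \quad\text{for all } k\ge 0.$$
   Context: All functions are convex and finite everywhere. $\mathcal{R}(A)$ denotes the range of $A$; $\|\cdot\|_2$ is the Euclidean norm of vectors and the spectral norm of matrices. A convex function $f:\mathbb{R}^n\to\mathbb{R}$ has subdifferential $\partial f(x)=\{x^*\in\mathbb{R}^n \mid f(y)\ge f(x)+\langle x^*,y-x\rangle \text{ for all } y\in\mathbb{R}^n\}$. It is strongly convex (with constant $\alpha>0$) if $f(y)\ge f(x)+\langle x^*,y-x\rangle+\frac{\alpha}{2}\|y-x\|_2^2$ for all $x,y\in\mathbb{R}^n$ and $x^*\in\partial f(x)$. Its conjugate is $f^*(x^* )=\sup_{y\in\mathbb{R}^n}\langle x^*,y\rangle-f(y)$; for $f$ strongly convex with constant $\alpha$, $f^*$ is finite everywhere and differentiable, with Lipschitz-continuous gradient with constant $L_{f^*}=\frac1\alpha$. $L_{g^*}>0$ denotes a Lipschitz constant of $\nabla g^*$. The Bregman distance between $x,y\in\mathbb{R}^n$ with respect to $f$ and $x^*\in\partial f(x)$ is $D_f^{x^*}(x,y)=f(y)-f(x)-\langle x^*,y-x\rangle$. The subdifferential mapping of $f$ grows at most linearly if there exist $\eta,\rho\ge 0$ such that $\|x^*\|_2\le\eta\|x\|_2+\rho$ for all $x\in\mathbb{R}^n$ and $x^*\in\partial f(x)$. GERK method. The matrix $A$ is partitioned into $M_r$ nonzero row-blocks $A_i\in\mathbb{R}^{m_i\times n}$, $i=1,\dots,M_r$, and also partitioned into $N_c$ nonzero column-blocks $\tilde{A}_j\in\mathbb{R}^{m\times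 n_j}$, $j=1,\dots,N_c$. For $v\in\mathbb{R}^m$, the subvector corresponding to the $i$-th row-block is denoted by $v_i\in\mathbb{R}^{m_i}$ (so $b_i$ is the $i$-th block of $b$ and $z^*_{k+1,i}$ is the $i$-th block of $z^*_{k+1}$). Let $p_i>0$ ($i=1,\dots,M_r$) and $\tilde p_j>0$ ($j=1,\dots,N_c$) be probabilities, $\sum_i p_i=1$, $\sum_j\tilde p_j=1$. Start with $x_0=x_0^*=0\in\mathbb{R}^n$, $z_0^*=b$, $z_0=\nabla g^*(z_0^* )$. For $k=0,1,2,\dots$: 1. choose a column-block index $j_k=j\in\{1,\dots,N_c\}$ at random with probability $\tilde p_j$; 2. $z_{k+1}^*=z_k^*-\tilde t_k\,\tilde A_{j_k}\tilde A_{j_k}^T z_k$ with $\tilde t_k=\frac{1}{L_{g^*}\|\tilde A_{j_k}\|_2^2}$; 3. $z_{k+1}=\nabla g^*(z_{k+1}^* )$; 4. choose a row-block index $i_k=i\in\{1,\dots,M_r\}$ at random with probability $p_i$; 5. $x_{k+1}^*=x_k^*-t_k\,A_{i_k}^T\big(A_{i_k}x_k-b_{i_k}+z^*_{k+1,i_k}\big)$ with $t_k=\frac{1}{L_{f^*}\|A_{i_k}\|_2^2}$; 6. $x_{k+1}=\nabla f^*(x_{k+1}^* )$. All random choices $j_0,i_0,j_1,i_1,\dots$ are independent. $\mathbb{E}$ denotes expectation with respect to these random choices. *)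

(* Defs.v *)
From HB Require Import structures.
From mathcomp Require Import all_boot all_order all_algebra.
From mathcomp Require Import finmap.
From mathcomp Require Import all_classical all_reals all_analysis.

Set Implicit Arguments.
Unset Strict Implicit.
Unset Printing Implicit Defensive.
Import Order.TTheory GRing.Theory Num.Theory.
Import numFieldNormedType.Exports.
Local Open Scope classical_set_scope.
Local Open Scope ring_scope.

Section euclidean.
Context {R : realType}.

Definition inner n (u v : 'cV[R]_n) : R := (u^T *m v) 0 0.

(* The canonical norm of a matrix in the library is the sup norm. *)
Definition l2norm n (u : 'cV[R]_n) : R := Num.sqrt (inner u u).

Definition spectral_norm m n (M : 'M[R]_(m, n)) : R :=
  sup [set l2norm (M *m u) | u in [set u : 'cV[R]_n | l2norm u <= 1]].

Definition col_range m n (M : 'M[R]_(m, n)) : set 'cV[R]_m :=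
  range (fun u : 'cV[R]_n => M *m u).

End euclidean.

Section convex_analysis.
Context {R : realType}.

Definition subdiff n (h : 'cV[R]_n -> R) (x : 'cV[R]_n) : set 'cV[R]_n :=
  [set xs | forall y, h x + inner xs (y - x) <= h y].

Definition strongly_convex n (alpha : R) (h : 'cV[R]_n -> R) : Prop :=
  [/\ 0 < alpha, @convex_function R 'cV[R]_n setT h &
      forall x y xs, subdiff h x xs ->
        h x + inner xs (y - x) + alpha / 2 * l2norm (y - x) ^+ 2 <= h y].

(* This is the conjugate whenever the supremum is finite, in particular for
   strongly convex h; otherwise the real-valued sup takes a junk value. *)
Definition conjugate n (h : 'cV[R]_n -> R) (xs : 'cV[R]_n) : R :=
  sup (range (fun y : 'cV[R]_n => inner xs y - h y)).

Definition gradient n (h : 'cV[R]_n -> R) (x : 'cV[R]_n) : 'cV[R]_n :=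
  \col_i 'D_(delta_mx i 0) (h : 'cV[R]_n -> R^o) x.

Definition lipschitz_gradient n (L : R) (h : 'cV[R]_n -> R) : Prop :=
  (forall x, differentiable (h : 'cV[R]_n -> R^o) x) /\
  (forall x y, l2norm (gradient h x - gradient h y) <= L * l2norm (x - y)).

Definition bregman n (h : 'cV[R]_n -> R) (x xs y : 'cV[R]_n) : R :=
  h y - h x - inner xs (y - x).

Definition subdiff_linear_growth n (h : 'cV[R]_n -> R) : Prop :=
  exists eta rho : R, [/\ 0 <= eta, 0 <= rho &
    forall x xs, subdiff h x xs -> l2norm xs <= eta * l2norm x + rho].

Definition global_error_bound m n (A : 'M[R]_(m, n)) (f : 'cV[R]_n -> R)
    (xhat : 'cV[R]_n) (yhat : 'cV[R]_m) : Prop :=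
  exists2 gamma : R, 0 < gamma &
    forall x xs, (subdiff f x `&` col_range A^T) xs ->
      bregman f x xs xhat <= gamma * l2norm (A *m x - yhat) ^+ 2.

Definition minimizer n (D : set 'cV[R]_n) (h : 'cV[R]_n -> R)
    (x : 'cV[R]_n) : Prop :=
  D x /\ forall y, D y -> h x <= h y.

End convex_analysis.

Section gerk.
Context {R : realType} {Mr Nc : nat} {mi : 'I_Mr -> nat} {nj : 'I_Nc -> nat}.
Let m := (\sum_i mi i)%N.
Let n := (\sum_j nj j)%N.
Variables (A : 'M[R]_(m, n)) (b : 'cV[R]_m).
Variables (f : 'cV[R]_n -> R) (gs : 'cV[R]_m -> R) (Lf Lg : R).

Record gerk_state := GerkState {
  gerk_x  : 'cV[R]_n;
  gerk_xs : 'cV[R]_n;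
  gerk_z  : 'cV[R]_m;
  gerk_zs : 'cV[R]_m }.

Definition gerk_init : gerk_state :=
  {| gerk_x := 0; gerk_xs := 0; gerk_z := gradient gs b; gerk_zs := b |}.

Definition gerk_step (s : gerk_state) (j : 'I_Nc) (i : 'I_Mr) : gerk_state :=
  let Aj : 'M[R]_(m, nj j) := submxrow A j in
  let Ai : 'M[R]_(mi i, n) := submxcol A i in
  let tz := 1 / (Lg * spectral_norm Aj ^+ 2) in
  let tx := 1 / (Lf * spectral_norm Ai ^+ 2) in
  let zs := gerk_zs s - tz *: (Aj *m (Aj^T *m gerk_z s)) in
  let xs := gerk_xs s - tx *:
    (Ai^T *m (Ai *m gerk_x s - submxcol b i + submxcol zs i)) in
  {| gerk_x := gradient (conjugate f) xs; gerk_xs := xs;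
     gerk_z := gradient gs zs; gerk_zs := zs |}.

Fixpoint gerk (js : nat -> 'I_Nc) (rs : nat -> 'I_Mr) (k : nat) : gerk_state :=
  if k is k'.+1 then gerk_step (gerk js rs k') (js k') (rs k') else gerk_init.

End gerk.

Section random_choices.
Context {d : measure_display} {T : measurableType d} {R : realType}.
Variable P : probability T R.

Definition mutually_independent (K : choiceType) (G : K -> set (set T)) : Prop :=
  forall (S : {fset K}) (E : K -> set T),
    (forall a, a \in S -> G a (E a)) ->
    P (\bigcap_(a in [set` S]) E a) = (\prod_(a <- S) P (E a))%E.

(* The sigma-algebra generated by X when V carries the discrete one. *)
Definition discrete_events (V : Type) (X : T -> V) : set (set T) :=
  [set X @^-1` B | B in [set: set V]].

Definition has_law (V : Type) (X : T -> V) (p : V -> R) : Prop :=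
  forall v, measurable (X @^-1` [set v]) /\ P (X @^-1` [set v]) = (p v)%:E.

Definition gerk_choices Mr Nc (p : 'I_Mr -> R) (pt : 'I_Nc -> R)
    (J : nat -> T -> 'I_Nc) (I : nat -> T -> 'I_Mr) : Prop :=
  [/\ forall k, has_law (J k) pt,
      forall k, has_law (I k) p &
      mutually_independent (fun a : nat + nat => match a with
        | inl k => discrete_events (J k)
        | inr k => discrete_events (I k)
        end)].

Definition mean_sq_error n (X : T -> 'cV[R]_n) (x : 'cV[R]_n) : \bar R :=
  ('E_P[fun w => (l2norm (X w - x) ^+ 2)%R])%E.

(* Convergence in mean square; by Jensen's inequality it entails convergence
   of the mean norm of the error, and of the expectations, as well. *)
Definition cvg_in_expectation n (X : nat -> T -> 'cV[R]_n) (x : 'cV[R]_n) :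
    Prop :=
  mean_sq_error (X k) x @[k --> \oo] --> 0%E.

End random_choices.

(* Main.v *)
Require Import Defs.
From HB Require Import structures.
From mathcomp Require Import all_boot all_order all_algebra.
From mathcomp Require Import finmap.
From mathcomp Require Import all_classical all_reals all_analysis.
From mathcomp Require Import measurable_realfun.
From mathcomp Require Import ring lra.

Set Implicit Arguments.
Unset Strict Implicit.
Unset Printing Implicit Defensive.
Import Order.TTheory GRing.Theory Num.Theory.
Import numFieldNormedType.Exports.
Local Open Scope classical_set_scope.
Local Open Scope ring_scope.

(** The [z]-iteration is a randomized block gradient method for minimizing
    [gs] over the affine space [b + range A], and the [x]-iteration is a
    randomized block dual gradient method for the constrained problem with
    right-hand side [b - z_k^*], which only converges to [yhat].

    For the first part, a step with column block [A_j] decreases [gs] by a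
    multiple of the squared norm of [A_j^T z] ([dual_block_descent]). The
    mean over [j] controls the squared norm of [A^T z], and strong convexity
    bounds the gap of the objective by it ([dual_gap_le_gradient]), because
    the displacement to the minimizer lies in the range of [A], where
    preimages under [A] are bounded. Hence the mean gap contracts
    ([dual_contraction]), and by strong convexity it dominates the squared
    distance to [b - yhat].

    For the second part, the Bregman distance [D_k] from [x_k] to [xhat] is
    the gap of the dual objective [f^* - inner _ xhat], which is smooth as
    [f] is strongly convex. A row step decreases it by a multiple of the
    squared block residual, up to the squared error of the right-hand side
    ([primal_block_step]). In the mean, [D_(k+1)] is at most [D_k] minus a
    multiple of [|A x_k - yhat| ^ 2] plus a geometric term
    ([primal_recursion]). An error bound makes the residual term
    proportional to [D_k], which gives the rate [(1 + k) q ^ k]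
    ([linear_recursion]). Under linear growth of the subdifferential, the
    optimal multiplier gives [D_k ^ 2 <= K (1 + D_k) |A x_k - yhat| ^ 2]
    ([primal_gap_growth]); since [x ^ 2 / (1 + x)] is convex, this passes to
    means and yields the rate [1 / k] ([quadratic_recursion]).

    The convex analysis rests on one Hahn-Banach argument
    ([subdiff_col_range]), which produces both subgradients and multipliers;
    existence of subgradients gives minimizers of strongly convex functions
    ([strong_minimizer]), and these give the conjugate and its gradient. On
    the probabilistic side, the iterates are a function of finitely many
    discrete independent choices, so expectations reduce to iterates of a
    finite averaging operator ([expectation_run]). *)

(** * Euclidean geometry of column vectors *)

Section inner_product.
Context {R : realType}.
Implicit Types (n m : nat).

Lemma innerE n (u v : 'cV[R]_n) : inner u v = \sum_i u i 0 * v i 0.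
Proof. by rewrite /inner mxE; apply: eq_bigr => i _; rewrite mxE. Qed.

Lemma innerC n (u v : 'cV[R]_n) : inner u v = inner v u.
Proof. by rewrite !innerE; apply: eq_bigr => i _; rewrite mulrC. Qed.

Lemma innerDr n (u v w : 'cV[R]_n) : inner u (v + w) = inner u v + inner u w.
Proof. by rewrite /inner mulmxDr mxE. Qed.

Lemma innerZr n a (u v : 'cV[R]_n) : inner u (a *: v) = a * inner u v.
Proof. by rewrite /inner -scalemxAr mxE. Qed.

Lemma innerNr n (u v : 'cV[R]_n) : inner u (- v) = - inner u v.
Proof. by rewrite -scaleN1r innerZr mulN1r. Qed.

Lemma innerDl n (u v w : 'cV[R]_n) : inner (u + v) w = inner u w + inner v w.
Proof. by rewrite innerC innerDr !(innerC w). Qed.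

Lemma innerZl n a (u v : 'cV[R]_n) : inner (a *: u) v = a * inner u v.
Proof. by rewrite innerC innerZr innerC. Qed.

Lemma innerNl n (u v : 'cV[R]_n) : inner (- u) v = - inner u v.
Proof. by rewrite innerC innerNr innerC. Qed.

Lemma inner0l n (u : 'cV[R]_n) : inner 0 u = 0.
Proof. by rewrite -(scale0r 0) innerZl mul0r. Qed.

Lemma inner0r n (u : 'cV[R]_n) : inner u 0 = 0.
Proof. by rewrite innerC inner0l. Qed.

Definition inner_lin := (innerDl, innerDr, innerNl, innerNr, innerZl, innerZr).

Lemma inner_mulmx n m (M : 'M[R]_(m, n)) u v :
  inner u (M *m v) = inner (M^T *m u) v.
Proof. by rewrite /inner trmx_mul trmxK mulmxA. Qed.

Lemma inner_ge0 n (u : 'cV[R]_n) : 0 <= inner u u.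
Proof. by rewrite innerE sumr_ge0// => i _; rewrite -expr2 sqr_ge0. Qed.

Lemma inner_eq0 n (u : 'cV[R]_n) : inner u u = 0 -> u = 0.
Proof.
rewrite innerE => /psumr_eq0P u0; apply/colP => i; rewrite mxE.
apply/eqP; rewrite -sqrf_eq0 expr2 u0// => j _.
by rewrite -expr2 sqr_ge0.
Qed.

Lemma l2norm_sq n (u : 'cV[R]_n) : l2norm u ^+ 2 = inner u u.
Proof. by rewrite sqr_sqrtr// inner_ge0. Qed.

Lemma l2norm_ge0 n (u : 'cV[R]_n) : 0 <= l2norm u.
Proof. exact: sqrtr_ge0. Qed.

Lemma l2norm0 n : l2norm (0 : 'cV[R]_n) = 0.
Proof. by rewrite /l2norm inner0l sqrtr0. Qed.

Lemma l2norm_eq0 n (u : 'cV[R]_n) : l2norm u = 0 -> u = 0.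
Proof. by move=> u0; apply: inner_eq0; rewrite -l2norm_sq u0 expr0n. Qed.

Lemma l2normN n (u : 'cV[R]_n) : l2norm (- u) = l2norm u.
Proof. by rewrite /l2norm !inner_lin opprK. Qed.

Lemma l2norm_distC n (u v : 'cV[R]_n) : l2norm (u - v) = l2norm (v - u).
Proof. by rewrite -l2normN opprB. Qed.

Lemma l2normZ n a (u : 'cV[R]_n) : l2norm (a *: u) = `|a| * l2norm u.
Proof.
by rewrite /l2norm !inner_lin mulrA -expr2 sqrtrM ?sqr_ge0// sqrtr_sqr.
Qed.

Lemma inner_young n (a : R) (u v : 'cV[R]_n) : 0 < a ->
  inner u v <= (2 * a)^-1 * l2norm u ^+ 2 + a / 2 * l2norm v ^+ 2.
Proof.
move=> a0; have := inner_ge0 (a^-1 *: u - v).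
rewrite !l2norm_sq !inner_lin (innerC v u) => h.
have {h} : 0 <= a / 2 *
    (a^-1 * (a^-1 * inner u u) - inner u v * a^-1 * 2 + inner v v).
  by apply: mulr_ge0; [rewrite divr_ge0// ltW | lra].
move=> h; rewrite -subr_ge0; apply: (le_trans h); rewrite le_eqVlt.
by apply/orP; left; apply/eqP; field; rewrite gt_eqF.
Qed.

Lemma cauchy_schwarz n (u v : 'cV[R]_n) : inner u v <= l2norm u * l2norm v.
Proof.
have [u0|u0] := eqVneq (l2norm u) 0.
  by rewrite u0 (l2norm_eq0 u0) inner0l mul0r.
have [v0|v0] := eqVneq (l2norm v) 0.
  by rewrite v0 (l2norm_eq0 v0) inner0r mulr0.
have a0 : 0 < l2norm u / l2norm v by rewrite divr_gt0// lt0r ?u0 ?v0 l2norm_ge0.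
apply: (le_trans (inner_young u v a0)); rewrite le_eqVlt; apply/orP; left.
by apply/eqP; field; rewrite u0 v0.
Qed.

Lemma ler_l2norm n m (u : 'cV[R]_n) (v : 'cV[R]_m) c : 0 <= c ->
  inner u u <= c ^+ 2 * inner v v -> l2norm u <= c * l2norm v.
Proof.
move=> c0 uv; rewrite -(@ler_pXn2r _ 2) ?nnegrE ?mulr_ge0 ?l2norm_ge0//.
by rewrite exprMn !l2norm_sq.
Qed.

Lemma l2norm_triangle n (u v : 'cV[R]_n) :
  l2norm (u + v) <= l2norm u + l2norm v.
Proof.
rewrite -(@ler_pXn2r _ 2) ?nnegrE ?addr_ge0 ?l2norm_ge0//.
rewrite sqrrD !l2norm_sq !inner_lin (innerC v u).
by have := cauchy_schwarz u v; lra.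
Qed.

Lemma coord_le_l2norm n (u : 'cV[R]_n) i : `|u i 0| <= l2norm u.
Proof.
rewrite -(@ler_pXn2r _ 2) ?nnegrE ?l2norm_ge0//.
rewrite l2norm_sq innerE real_normK ?num_real// (bigD1 i)//= -expr2 lerDl.
by rewrite sumr_ge0// => j _; rewrite -expr2 sqr_ge0.
Qed.

Lemma l2norm_bounded n m (M : 'M[R]_(m, n)) :
  exists2 c, 0 < c & forall u : 'cV[R]_n, l2norm (M *m u) <= c * l2norm u.
Proof.
pose F := \sum_i l2norm (row i M)^T ^+ 2.
have F0 : 0 <= F by rewrite sumr_ge0// => i _; rewrite sqr_ge0.
exists (1 + F); first by rewrite ltr_wpDr.
move=> u; apply: ler_l2norm; first by rewrite addr_ge0.
apply: (@le_trans _ _ (F * inner u u)); last first.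
  by rewrite ler_wpM2r ?inner_ge0// sqrrD expr1n; nra.
rewrite innerE mulr_suml ler_sum// => i _.
have -> : (M *m u) i 0 = inner (row i M)^T u.
  by rewrite innerE mxE; apply: eq_bigr => j _; rewrite !mxE.
rewrite -[leRHS]mulr1 -expr2 -l2norm_sq -exprMn mulr1.
have := cauchy_schwarz (row i M)^T u.
have := cauchy_schwarz (- (row i M)^T) u; rewrite l2normN innerNl => h1 h2.
rewrite -real_normK ?num_real// ler_pXn2r ?nnegrE ?mulr_ge0 ?l2norm_ge0//.
by rewrite ler_norml h2 lerNl h1.
Qed.

End inner_product.

Section spectral_norm.
Context {R : realType} {m n : nat}.
Implicit Types M : 'M[R]_(m, n).

Lemma spectral_norm_ub M :
  ubound [set l2norm (M *m u) | u in [set u : 'cV[R]_n | l2norm u <= 1]]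
    (spectral_norm M).
Proof.
apply: sup_upper_bound; split.
  by exists (l2norm (M *m 0)); exists 0 => //=; rewrite l2norm0.
have [c c0 cM] := l2norm_bounded M; exists c => _ [u /= u1 <-].
by rewrite (le_trans (cM u))// ler_piMr// ltW.
Qed.

Lemma spectral_norm_ge M u : l2norm (M *m u) <= spectral_norm M * l2norm u.
Proof.
have [u0|u0] := eqVneq (l2norm u) 0.
  by rewrite u0 (l2norm_eq0 u0) mulmx0 l2norm0 mulr0.
have {}u0 : 0 < l2norm u by rewrite lt0r u0 l2norm_ge0.
have /(spectral_norm_ub (M := M)) : [set l2norm (M *m u) | u in
    [set u : 'cV[R]_n | l2norm u <= 1]] (l2norm (M *m ((l2norm u)^-1 *: u))).
  exists ((l2norm u)^-1 *: u) => //=.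
  by rewrite l2normZ ger0_norm ?invr_ge0 ?l2norm_ge0// mulVf// gt_eqF.
rewrite -scalemxAr l2normZ ger0_norm ?invr_ge0 ?l2norm_ge0//.
by rewrite mulrC ler_pdivrMr.
Qed.

Lemma spectral_norm_gt0 M : M != 0 -> 0 < spectral_norm M.
Proof.
apply: contra_neqT; rewrite -leNgt => M0; apply/matrixP => i j; rewrite mxE.
have := le_trans (coord_le_l2norm _ i) (spectral_norm_ge M (delta_mx j 0)).
rewrite -colE mxE => /le_trans/(_ (_ : _ <= 0))Mij.
by apply/eqP; rewrite -normr_le0 Mij// mulr_le0_ge0 ?l2norm_ge0.
Qed.

Lemma spectral_norm_tr_ge M (u : 'cV[R]_m) : 0 < spectral_norm M ->
  l2norm (M^T *m u) <= spectral_norm M * l2norm u.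
Proof.
move=> M0; have [u0|u0] := eqVneq (l2norm (M^T *m u)) 0.
  by rewrite u0 mulr_ge0 ?l2norm_ge0// ltW.
have {}u0 : 0 < l2norm (M^T *m u) by rewrite lt0r u0 l2norm_ge0.
rewrite -(ler_pM2r u0) -expr2 l2norm_sq -inner_mulmx.
apply: (le_trans (cauchy_schwarz _ _)).
rewrite -mulrA mulrCA ler_wpM2l ?l2norm_ge0//.
exact: spectral_norm_ge.
Qed.

End spectral_norm.

Section range.
Context {R : realType}.
Implicit Types m n : nat.

Lemma col_rangeP m n (A : 'M[R]_(m, n)) y :
  col_range A y <-> A *m ((pinvmx A^T)^T *m y) = y.
Proof.
split=> [[u _ <-]|<-]; last by exists ((pinvmx A^T)^T *m y).
apply: trmx_inj; rewrite [in LHS]trmx_mul [in LHS]trmx_mul trmxK.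
by rewrite mulmxKpV// trmx_mul submxMl.
Qed.

(** A generalized inverse is a bounded linear choice of preimages.  The constant
    plays the part of the inverse of the smallest nonzero singular value of
    [A]. *)
Lemma col_range_preimage m n (A : 'M[R]_(m, n)) :
  exists2 c, 0 < c & forall y, col_range A y ->
    exists2 u, A *m u = y & l2norm u <= c * l2norm y.
Proof.
have [c c0 cA] := l2norm_bounded (pinvmx A^T)^T.
by exists c => // y /col_rangeP yA; exists ((pinvmx A^T)^T *m y).
Qed.

(** The fundamental theorem of linear algebra: the orthogonal complement of
    the kernel is the range of the transpose. *)
Lemma orth_ker_col_range m n (A : 'M[R]_(m, n)) s :
  (forall v, A *m v = 0 -> inner s v = 0) -> col_range A^T s.
Proof.
move=> sA; have /submxP[D sD] : (s^T <= A)%MS.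
  rewrite submxE; apply/eqP/rowP => j; rewrite [RHS]mxE.
  have := sA (col j (cokermx A)); rewrite !colE mulmxA mulmx_coker mul0mx.
  by move=> /(_ erefl); rewrite /inner mulmxA -colE mxE.
by exists D^T => //; rewrite -trmx_mul -sD trmxK.
Qed.

Lemma col_rangeD m n (A : 'M[R]_(m, n)) u v :
  col_range A u -> col_range A v -> col_range A (u + v).
Proof. by move=> [x _ <-] [y _ <-]; exists (x + y); rewrite ?mulmxDr. Qed.

Lemma col_rangeZ m n (A : 'M[R]_(m, n)) a u :
  col_range A u -> col_range A (a *: u).
Proof. by move=> [x _ <-]; exists (a *: x); rewrite ?scalemxAr. Qed.

Lemma col_rangeB m n (A : 'M[R]_(m, n)) u v :
  col_range A u -> col_range A v -> col_range A (u - v).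
Proof. by move=> uA vA; rewrite -scaleN1r; apply/col_rangeD/col_rangeZ. Qed.

End range.

Section blocks.
Context {R : realType}.

Lemma l2norm_submxcol k (mi : 'I_k -> nat) (v : 'cV[R]_(\sum_i mi i)) :
  l2norm v ^+ 2 = \sum_i l2norm (submxcol v i) ^+ 2.
Proof.
rewrite l2norm_sq /inner -{1 2}(submxcolK v) tr_mxcol mul_mxrow_mxcol.
by rewrite summxE; apply: eq_bigr => i _; rewrite l2norm_sq.
Qed.

Lemma col_range_submxrow k (nj : 'I_k -> nat) m
    (A : 'M[R]_(m, \sum_j nj j)) j u : col_range A (submxrow A j *m u).
Proof.
rewrite -[in submxrow A j](mulmx1 A) -mul_submxrow -mulmxA.
by exists (submxrow 1%:M j *m u).
Qed.

Lemma col_range_tr_submxcol k (mi : 'I_k -> nat) n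
    (A : 'M[R]_(\sum_i mi i, n)) i u :
  col_range A^T ((submxcol A i)^T *m u).
Proof. by rewrite tr_submxcol; apply: col_range_submxrow. Qed.

End blocks.

(** * Subgradients of convex functions *)

Section subgradient_existence.
Context {R : realType} {n : nat}.
Implicit Types (h : 'cV[R]_n -> R) (x y v w s : 'cV[R]_n).

Lemma convex_functionW h : convex_function [set: 'cV[R]_n] h ->
  forall (x y : 'cV[R]_n) a b, 0 <= a -> 0 <= b -> a + b = 1 ->
  h (a *: x + b *: y) <= a * h x + b * h y.
Proof.
move=> hc x y a b a0 b0 ab.
have a1 : a <= 1 by rewrite -ab lerDl.
have := hc (Itv01 a0 a1) x y; rewrite !inE => /(_ Logic.I Logic.I).
have -> : b = 1 - a by rewrite -ab addrC addKr.
exact.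
Qed.

(** One step of the Hahn-Banach extension: [G] is the graph of an affine
    minorant of [h (x + _)] on a convex set of directions, and the slope along
    [e] lies between the backward and the forward difference quotients, which
    convexity orders. *)
Lemma affine_minorant_extend h x e (G : 'cV[R]_n -> R -> Prop) :
  convex_function [set: 'cV[R]_n] h ->
  G 0 0 ->
  (forall v w r (s : R) a b, G v r -> G w s -> 0 <= a -> 0 <= b -> a + b = 1 ->
     G (a *: v + b *: w) (a * r + b * s)) ->
  (forall v r, G v r -> h x + r <= h (x + v)) ->
  exists c, forall v r t, G v r -> h x + (r + t * c) <= h (x + (v + t *: e)).
Proof.
move=> /convex_functionW hc G0 Gc hG.
pose low := [set l | exists v r t, [/\ 0 < t, G v r &
  l = (h x + r - h (x + (v - t *: e))) / t]].
have lowP v r t w (s : R) u : 0 < t -> 0 < u -> G v r -> G w s ->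
    (h x + r - h (x + (v - t *: e))) / t <=
    (h (x + (w + u *: e)) - (h x + s)) / u.
  move=> t0 u0 Gv Gw; rewrite ler_pdivrMr// mulrAC ler_pdivlMr//.
  have tu0 : 0 < t + u by rewrite addr_gt0.
  have Guv := Gc _ _ _ _ (u / (t + u)) (t / (t + u)) Gv Gw.
  have {}/Guv Guv : 0 <= u / (t + u) by rewrite divr_ge0// ltW.
  have {}/Guv Guv : 0 <= t / (t + u) by rewrite divr_ge0// ltW.
  have /Guv/hG{Guv} : u / (t + u) + t / (t + u) = 1.
    by field; rewrite gt_eqF.
  have := hc (x + (v - t *: e)) (x + (w + u *: e)) (u / (t + u)) (t / (t + u)).
  move=> /(_ (divr_ge0 (ltW u0) (ltW tu0)) (divr_ge0 (ltW t0) (ltW tu0))).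
  have -> : u / (t + u) *: (x + (v - t *: e)) +
      t / (t + u) *: (x + (w + u *: e)) =
      x + (u / (t + u) *: v + t / (t + u) *: w).
    by apply/colP => i; rewrite !mxE; field; rewrite gt_eqF.
  have /[swap]/[apply] : u / (t + u) + t / (t + u) = 1.
    by field; rewrite gt_eqF.
  move=> h1 h2; have := le_trans h2 h1.
  rewrite -subr_ge0 -(pmulr_rge0 _ tu0) -[in X in _ -> X]subr_ge0.
  by congr (0 <= _); field; rewrite gt_eqF.
exists (sup low) => v r t Gv.
have low_ub w (s : R) u : 0 < u -> G w s ->
    ubound low ((h (x + (w + u *: e)) - (h x + s)) / u).
  by move=> u0 Gw _ [v' [r' [t' [t'0 Gv' ->]]]]; apply: lowP.
have low0 : low !=set0.
  by eexists; exists 0, 0, 1; split; [exact: ltr01|exact: G0|reflexivity].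
have lows : has_sup low by split => //; eexists; exact: (low_ub 0 0 1).
have [t0|t0|->] := ltgtP t 0; last first.
- by rewrite mul0r scale0r !addr0; exact: hG.
- have := ge_sup low0 (low_ub _ _ _ t0 Gv).
  by rewrite ler_pdivlMr// mulrC; lra.
- have t0' : 0 < - t by rewrite oppr_gt0.
  have /(sup_upper_bound lows) :
      low ((h x + r - h (x + (v - (- t) *: e))) / - t) by exists v, r, (- t).
  by rewrite ler_pdivrMr// scaleNr opprK mulrN (mulrC _ t); lra.
Qed.

Lemma inner_delta s (i : 'I_n) : inner s (delta_mx i 0) = s i 0.
Proof.
rewrite innerE (bigD1 i)//= mxE !eqxx mulr1 big1 ?addr0// => j ji.
by rewrite mxE (negPf ji) mulr0.
Qed.

(** The zero functional on [ker A], a minorant of [h (x + _) - h x] by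
    minimality, is extended one coordinate direction at a time; the extension
    vanishes on the kernel, hence lies in the range of [A^T].  With [A] injective
    this is the existence of subgradients, and otherwise the multiplier rule for
    linear constraints. *)
Lemma subdiff_col_range m (A : 'M[R]_(m, n)) h x :
  convex_function [set: 'cV[R]_n] h ->
  (forall v, A *m v = 0 -> h x <= h (x + v)) ->
  exists2 s, subdiff h x s & col_range A^T s.
Proof.
move=> hc hA.
have ext p : (p <= n)%N -> exists s, forall v w, A *m v = 0 ->
    (forall i : 'I_n, (p <= i)%N -> w i 0 = 0) ->
    h x + inner s w <= h (x + (v + w)).
  elim: p => [_|p IH pn].
    exists 0 => v w Av w0; rewrite inner0l addr0.
    have -> : w = 0 by apply/colP => i; rewrite w0// mxE.
    by rewrite addr0; apply: hA.
  have [s sP] := IH (ltnW pn).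
  pose G u r := exists v w, [/\ A *m v = 0,
    forall i : 'I_n, (p <= i)%N -> w i 0 = 0, u = v + w & r = inner s w].
  have := @affine_minorant_extend h x (delta_mx (Ordinal pn) 0) G hc.
  case=> [||u r [v [w [Av w0 -> ->]]]|c cP].
  - exists 0, 0; split; rewrite ?mulmx0 ?addr0 ?inner0r//.
    by move=> i _; rewrite mxE.
  - move=> _ _ _ _ a b
      [v1 [w1 [Av1 w10 -> ->]]] [v2 [w2 [Av2 w20 -> ->]]] _ _ _.
    exists (a *: v1 + b *: v2), (a *: w1 + b *: w2); split.
    + by rewrite mulmxDr -!scalemxAr Av1 Av2 !scaler0 addr0.
    + by move=> i pi; rewrite !mxE w10// w20// !mulr0 addr0.
    + by rewrite !scalerDr addrACA.
    + by rewrite !inner_lin.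
  - exact: sP.
  exists (s + (c - s (Ordinal pn) 0) *: delta_mx (Ordinal pn) 0) => v w Av w0.
  pose t := w (Ordinal pn) 0; pose w' := w - t *: delta_mx (Ordinal pn) 0.
  have w'0 (i : 'I_n) : (p <= i)%N -> w' i 0 = 0.
    rewrite leq_eqVlt => /predU1P[pi|pi]; rewrite !mxE.
      by rewrite (_ : i = Ordinal pn) ?eqxx ?mulr1 ?subrr//; apply/val_inj.
    rewrite w0// (_ : (i == _) = false) ?mulr0 ?subr0//.
    by apply/negbTE; rewrite -val_eqE/= gtn_eqF.
  have Gvw : G (v + w') (inner s w') by exists v, w'.
  have := cP _ _ t Gvw.
  rewrite -addrA subrK; apply: le_trans.
  rewrite !inner_lin (innerC (delta_mx _ _)) !inner_delta -/t.
  by rewrite lerD2l le_eqVlt; apply/orP; left; apply/eqP; ring.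
have [s {}ext] := ext n (leqnn n).
have sP v w : A *m v = 0 -> h x + inner s w <= h (x + (v + w)).
  by move=> Av; apply: ext => // i; rewrite leqNgt ltn_ord.
exists s.
  move=> y; have := sP 0 (y - x); rewrite add0r subrKC.
  by apply; rewrite mulmx0.
apply: orth_ker_col_range => v Av; apply: le_anti.
have := sP v (- v) Av; rewrite subrr addr0 gerDl innerNr oppr_le0 => ->.
have := sP (- v) v; rewrite addNr addr0 gerDl mulmxN Av oppr0 => ->//.
Qed.

Lemma subdiff_nonempty h x :
  convex_function [set: 'cV[R]_n] h -> exists s, subdiff h x s.
Proof.
move=> hc; have [|s sx _] := @subdiff_col_range n 1%:M h x hc; last by exists s.
by move=> v; rewrite mul1mx => ->; rewrite addr0.
Qed.

End subgradient_existence.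

(** * Minimizers of strongly convex functions *)

Section completeness.
Context {R : realType}.

Lemma l2norm_complete n (u : nat -> 'cV[R]_n) (e : nat -> R) :
  e @ \oo --> 0 ->
  (forall k l, (k <= l)%N -> l2norm (u k - u l) <= e k) ->
  exists v, forall k, l2norm (u k - v) <= e k.
Proof.
move=> e0 ue.
have uc i : cvg ((fun k => u k i 0) @ \oo).
  apply: cauchy_cvg; apply: cauchy_exP => eps eps0.
  have /cvgrPdist_lt/(_ _ eps0)[K _ Ke] := e0.
  exists (u K i 0); exists K => // l /= Kl.
  rewrite /ball/=; apply: le_lt_trans (Ke K (leqnn K)).
  have := coord_le_l2norm (u K - u l) i; rewrite !mxE => /le_trans; apply.
  by rewrite sub0r normrN (le_trans (ue _ _ Kl))// ler_norm.
exists (\col_i lim ((fun k => u k i 0) @ \oo)) => k.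
have ek0 : 0 <= e k := le_trans (l2norm_ge0 _) (ue _ _ (leqnn k)).
rewrite -(@ler_pXn2r _ 2) ?nnegrE ?l2norm_ge0// l2norm_sq innerE.
have : (\sum_i (u k i 0 - u l i 0) * (u k i 0 - u l i 0)) @[l --> \oo] -->
    \sum_i ((u k - \col_i lim ((fun k => u k i 0) @ \oo)) i 0 *
            (u k - \col_i lim ((fun k => u k i 0) @ \oo)) i 0).
  apply: cvg_big => [|i _]; first exact: add_continuous.
  have uki : u k i 0 - u l i 0 @[l --> \oo] -->
      (u k - \col_i lim ((fun k => u k i 0) @ \oo)) i 0.
    by rewrite !mxE; apply: cvgB; [exact: cvg_cst|exact: uc].
  exact: cvgM.
move/cvgr_to_le; apply; exists k => // l /= kl.
have := ue _ _ kl; rewrite -(@ler_pXn2r _ 2) ?nnegrE ?l2norm_ge0//.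
rewrite l2norm_sq innerE; congr (_ <= _).
by apply: eq_bigr => i _; rewrite !mxE.
Qed.

End completeness.

(** The form in which strong convexity is used to minimize: at every point some
    affine minorant remains one after adding the quadratic.  It is stable under
    linear perturbations and reflections, and it contains the lower
    semicontinuity of [h]. *)
Definition strongly_subdifferentiable {R : realType} n (a : R)
    (h : 'cV[R]_n -> R) :=
  forall x, exists s, forall y,
    h x + inner s (y - x) + a / 2 * l2norm (y - x) ^+ 2 <= h y.

Section strongly_subdifferentiable.
Context {R : realType} {n : nat}.
Variables (a : R) (h : 'cV[R]_n -> R).
Hypotheses (a0 : 0 < a) (ha : strongly_subdifferentiable a h).

Lemma strong_midpoint x y :
  2 * h (2^-1 *: (x + y)) + a / 4 * l2norm (x - y) ^+ 2 <= h x + h y.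
Proof.
have [s sP] := ha (2^-1 *: (x + y)); have := sP x; have := sP y.
have -> : x - 2^-1 *: (x + y) = 2^-1 *: (x - y).
  by apply/colP => i; rewrite !mxE; field.
have -> : y - 2^-1 *: (x + y) = (- 2^-1) *: (x - y).
  by apply/colP => i; rewrite !mxE; field.
rewrite !innerZr !l2normZ normrN ger0_norm ?invr_ge0//.
by rewrite exprMn; lra.
Qed.

Lemma strong_lower_bound : exists c, forall y, c <= h y.
Proof.
have [s sP] := ha 0; exists (h 0 - (2 * a)^-1 * l2norm s ^+ 2) => y.
apply: le_trans (sP y); rewrite subr0.
have := inner_young (- s) y a0; rewrite l2normN innerNl.
by lra.
Qed.

Context {m : nat}.
Variables (M : 'M[R]_(m, n)) (c : 'cV[R]_m).

Lemma strong_minimizer_growth x y :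
  minimizer [set u | M *m u = c] h x -> M *m y = c ->
  a / 4 * l2norm (y - x) ^+ 2 <= h y - h x.
Proof.
move=> [/= Mx xmin] My; have := strong_midpoint y x.
have /xmin : M *m (2^-1 *: (y + x)) = c.
  by rewrite -scalemxAr mulmxDr Mx My; apply/colP => i; rewrite !mxE; field.
by lra.
Qed.

(** Existence without compactness: by the midpoint inequality a minimizing
    sequence is a Cauchy sequence, and the affine minorant at its limit
    replaces the continuity of [h]. *)
Lemma strong_minimizer u0 : M *m u0 = c ->
  exists x, unique (minimizer [set u | M *m u = c] h) x.
Proof.
move=> Mu0; set D := [set u | M *m u = c].
have [lb hlb] := strong_lower_bound.
have hasinf : has_inf (h @` D).
  by split; [exists (h u0), u0 | exists lb => _ [y _ <-]].
pose i0 := inf (h @` D).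
have i0_le y : D y -> i0 <= h y.
  by move=> Dy; apply: ge_inf; [case: hasinf|exists y].
have harm0 k : 0 < k.+1%:R^-1 :> R by rewrite invr_gt0.
pose e k : R := a / 8 * k.+1%:R^-1 ^+ 2.
have e0 k : 0 < e k by rewrite mulr_gt0 ?divr_gt0 ?exprn_gt0.
have /choice[u uP] k : exists y, D y /\ h y < i0 + e k.
  by have [_ [y Dy <-] hy] := inf_adherent (e0 k) hasinf; exists y.
have [||x xP] := @l2norm_complete _ _ u harmonic; first exact: cvg_harmonic.
  move=> k l kl; rewrite /harmonic/=.
  rewrite -(@ler_pXn2r _ 2) ?nnegrE ?l2norm_ge0 ?(ltW (harm0 _))//.
  have [[Dk hk] [Dl hl]] := (uP k, uP l).
  have /i0_le mid : D (2^-1 *: (u k + u l)).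
    rewrite /D/= -scalemxAr mulmxDr Dk Dl.
    by apply/colP => i; rewrite !mxE; field.
  have ekl : e l <= e k.
    rewrite /e ler_wpM2l ?(divr_ge0 (ltW a0))//.
    by rewrite ler_pXn2r ?nnegrE ?invr_ge0// lef_pV2 ?posrE// ler_nat.
  have a8 : 0 < a / 4 by rewrite divr_gt0.
  rewrite -(ler_pM2l a8); have := strong_midpoint (u k) (u l).
  move: hk hl ekl; rewrite /e; move: (k.+1%:R^-1) (l.+1%:R^-1) => ek el.
  lra.
have xmin : minimizer D h x.
  split=> [|y Dy].
    rewrite /D/=; apply/eqP; rewrite -subr_eq0; apply/eqP/l2norm_eq0/le_anti.
    rewrite l2norm_ge0 andbT.
    have [C C0 CM] := l2norm_bounded M.
    have : C * harmonic k @[k --> \oo] --> C * 0.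
      by apply: cvgM; [exact: cvg_cst|exact: cvg_harmonic].
    rewrite mulr0 => /cvgr_to_ge; apply; near=> k.
    have [Dk _] := uP k; rewrite -Dk -mulmxBr (le_trans (CM _))//.
    by rewrite ler_pM2l// l2norm_distC.
  apply: le_trans (i0_le _ Dy); have [s sP] := ha x.
  rewrite -subr_le0.
  have : a / 8 * (harmonic k * harmonic k) + l2norm s * harmonic k @[k --> \oo]
      --> a / 8 * (0 * 0) + l2norm s * 0.
    apply: cvgD; apply: cvgM; try exact: cvg_cst; last exact: cvg_harmonic.
    by apply: cvgM; exact: cvg_harmonic.
  rewrite !mulr0 addr0 => /cvgr_to_ge; apply; near=> k.
  have [_ hk] := uP k; have := sP (u k).
  have := cauchy_schwarz (- s) (u k - x); rewrite innerNl l2normN.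
  have := ler_wpM2l (l2norm_ge0 s) (xP k).
  have : 0 <= a / 2 * l2norm (u k - x) ^+ 2.
    by apply: mulr_ge0; [rewrite divr_ge0// ltW|rewrite sqr_ge0].
  move: hk; rewrite /e /harmonic/=; move: (k.+1%:R^-1) => ek.
  lra.
exists x; split=> // y [Dy ymin].
have hyx : h y - h x <= 0 by rewrite subr_le0; apply: ymin xmin.1.
have := le_trans (strong_minimizer_growth xmin Dy) hyx.
rewrite pmulr_rle0 ?divr_gt0//.
move=> yx; apply/esym/eqP; rewrite -subr_eq0; apply/eqP/l2norm_eq0/eqP.
by rewrite -sqrf_eq0; apply/eqP/le_anti; rewrite yx sqr_ge0.
Unshelve. all: by end_near. Qed.

End strongly_subdifferentiable.

Lemma strongly_convex_subdifferentiable {R : realType} n (a : R)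
    (h : 'cV[R]_n -> R) :
  strongly_convex a h -> strongly_subdifferentiable a h.
Proof.
move=> [_ hc ha] x; have [s sx] := subdiff_nonempty x hc.
by exists s => y; apply: ha.
Qed.

(** * Gradients *)

Section gradient.
Context {R : realType} {n : nat}.
Implicit Types (h : 'cV[R]_n -> R) (x y s : 'cV[R]_n).

(** A subgradient bounds the difference quotients of a coordinate direction from
    one side for positive increments and from the other for negative ones, and
    both families converge to the partial derivative. *)
Lemma gradient_subdiff h x s :
  differentiable (h : 'cV[R]_n -> R^o) x -> subdiff h x s -> gradient h x = s.
Proof.
move=> dh sx; apply/colP => i; rewrite mxE.
have /= dhi := @diff_derivable _ _ _ h x (delta_mx i 0) dh.
have hge (t : R) : t * s i 0 <= h (t *: delta_mx i 0 + x) - h x.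
  have := sx (t *: delta_mx i 0 + x); rewrite addrK innerZr inner_delta.
  by rewrite lerBrDl.
apply: le_anti; apply/andP; split.
  rewrite ['D__ _ _]cvg_at_leftE//; apply: limr_le.
    apply/cvg_ex; exists ('D_(delta_mx i 0) (h : 'cV[R]_n -> R^o) x).
    exact: cvg_dnbhs_at_left.
  near=> t; have t0 : t < 0 by [].
  rewrite /= -[leLHS]/(t^-1 * _) mulrC ler_ndivrMr// mulrC.
  exact: hge.
rewrite ['D__ _ _]cvg_at_rightE//; apply: limr_ge.
  apply/cvg_ex; exists ('D_(delta_mx i 0) (h : 'cV[R]_n -> R^o) x).
  exact: cvg_dnbhs_at_right.
near=> t; have t0 : 0 < t by [].
rewrite /= -[leRHS]/(t^-1 * _) mulrC ler_pdivlMr// mulrC.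
exact: hge.
Unshelve. all: by end_near. Qed.

Lemma gradient_quadratic h x s c :
  subdiff h x s ->
  (forall y, h y <= h x + inner s (y - x) + c * l2norm (y - x) ^+ 2) ->
  gradient h x = s.
Proof.
move=> sx hc; apply/colP => i; rewrite mxE.
have l2d : l2norm (delta_mx i 0 : 'cV[R]_n) ^+ 2 = 1.
  by rewrite l2norm_sq inner_delta mxE !eqxx.
have c0 : 0 <= c.
  have := le_trans (sx (x + delta_mx i 0)) (hc (x + delta_mx i 0)).
  by rewrite [x + _]addrC addrK l2d mulr1 lerDl.
apply: cvg_lim => //; apply/cvgrPdist_le => /= e e0.
near=> t; have t0 : t != 0 by near: t; exact: nbhs_dnbhs_neq.
have te : `|t| * (c + 1) <= e.
  rewrite -ler_pdivlMr ?ltr_wpDl//; near: t; apply: dnbhs0_le.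
  by rewrite divr_gt0// ltr_wpDl.
rewrite -[_ *: _]/(t^-1 * (h (t *: delta_mx i 0 + x) - h x)).
have := sx (t *: delta_mx i 0 + x); have := hc (t *: delta_mx i 0 + x).
rewrite addrK innerZr inner_delta l2normZ exprMn l2d mulr1.
move: (h (t *: _ + _)) => y hy1 hy2.
have -> : s i 0 - t^-1 * (y - h x) = t^-1 * (h x + t * s i 0 - y).
  by field.
rewrite normrM normfV ler_pdivrMl ?normr_gt0//.
have : `|t| * (`|t| * (c + 1)) <= `|t| * e by rewrite ler_wpM2l.
apply: le_trans; rewrite ler_norml mulrA -expr2 real_normK ?num_real//.
move: hy1 hy2; rewrite real_normK ?num_real//.
by have := sqr_ge0 t; lra.
Unshelve. all: by end_near. Qed.

(** Splitting the segment at its midpoint and bounding the gradient at the far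
    end of each half costs 3/4 in place of the optimal 1/2 given by
    integration; any constant below 1 makes a gradient step of length [1 / L]
    decrease [h]. *)
Lemma lipschitz_gradient_descent h L x y :
  convex_function [set: 'cV[R]_n] h -> lipschitz_gradient L h ->
  h y <= h x + inner (gradient h x) (y - x) + 3 / 4 * L * l2norm (y - x) ^+ 2.
Proof.
move=> hc [dh hL]; pose w := 2^-1 *: (x + y).
have grad u : subdiff h u (gradient h u).
  by have [s su] := subdiff_nonempty u hc; rewrite (gradient_subdiff (dh u) su).
have xw : x - w = - 2^-1 *: (y - x).
  by apply/colP => i; rewrite !mxE; field.
have wy : w - y = - 2^-1 *: (y - x).
  by apply/colP => i; rewrite !mxE; field.
have wx : w - x = 2^-1 *: (y - x) by rewrite -opprB xw scaleNr opprK.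
have := grad w x; have := grad y w.
rewrite xw wy !innerZr.
have := cauchy_schwarz (gradient h w - gradient h x) (y - x).
have := cauchy_schwarz (gradient h y - gradient h x) (y - x).
have := ler_wpM2r (l2norm_ge0 (y - x)) (hL w x).
have := ler_wpM2r (l2norm_ge0 (y - x)) (hL y x).
rewrite wx l2normZ ger0_norm ?invr_ge0// !inner_lin expr2.
by move: (l2norm (y - x)) => d; lra.
Qed.

End gradient.

(** * The conjugate of a strongly convex function *)

Section conjugate.
Context {R : realType} {n : nat}.
Variables (a : R) (f : 'cV[R]_n -> R).
Hypothesis fa : strongly_convex a f.
Implicit Types (x y xs ys : 'cV[R]_n).

(** The tilted function [f - inner xs] is again strongly convex, and [xs] is a
    subgradient of [f] at its minimizer. *)
Lemma strong_subdiff_surj xs : exists x, subdiff f x xs.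
Proof.
have a0 : 0 < a by case: fa.
pose h y := f y - inner xs y.
have ha : strongly_subdifferentiable a h.
  move=> x; have [s sP] := strongly_convex_subdifferentiable fa x.
  exists (s - xs) => y; have := sP y.
  by rewrite /h innerDl innerNl [inner xs (y - x)]innerDr innerNr; lra.
have [x [[_ xmin] _]] := strong_minimizer a0 ha (mul0mx 1 (0 : 'cV[R]_n)).
exists x => y; have := xmin y.
rewrite /h innerDr innerNr /= mul0mx => /(_ erefl).
by lra.
Qed.

Lemma conjugate_subdiff x xs :
  subdiff f x xs -> conjugate f xs = inner xs x - f x.
Proof.
move=> fx; apply: le_anti; apply/andP; split.
  apply: ge_sup; first by exists (inner xs x - f x), x.
  by move=> _ [y _ <-]; have := fx y; rewrite innerDr innerNr; lra.
apply: ub_le_sup; last by exists x.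
exists (inner xs x - f x) => _ [y _ <-].
by have := fx y; rewrite innerDr innerNr; lra.
Qed.

(** The conjugate at [ys] is attained at some [y], and the quadratic that strong
    convexity provides between [x] and [y] absorbs the cross term
    [inner (ys - xs) (y - x)] by Young's inequality. *)
Lemma conjugate_smooth x xs ys : subdiff f x xs ->
  conjugate f ys <=
    conjugate f xs + inner x (ys - xs) + (2 * a)^-1 * l2norm (ys - xs) ^+ 2.
Proof.
have [a0 _ fS] := fa.
move=> fx; have [y fy] := strong_subdiff_surj ys.
rewrite (conjugate_subdiff fx) (conjugate_subdiff fy).
have := fS x y xs fx; have := inner_young (ys - xs) (y - x) a0.
by rewrite !inner_lin !(innerC x); lra.
Qed.

Lemma gradient_conjugate x xs :
  subdiff f x xs -> gradient (conjugate f) xs = x.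
Proof.
move=> fx; apply: (@gradient_quadratic _ _ _ _ _ (2 * a)^-1) => ys.
  have [y fy] := strong_subdiff_surj ys.
  rewrite (conjugate_subdiff fx) (conjugate_subdiff fy).
  by have := fy x; rewrite !inner_lin !(innerC x); lra.
exact: conjugate_smooth.
Qed.

Lemma subdiff_gradient_conjugate xs :
  subdiff f (gradient (conjugate f) xs) xs.
Proof.
by have [x fx] := strong_subdiff_surj xs; rewrite (gradient_conjugate fx).
Qed.

End conjugate.

(** * The dual problem and the gap of the dual iterates *)

Section dual.
Context {R : realType} {m n : nat}.
Variables (A : 'M[R]_(m, n)) (b : 'cV[R]_m) (gs : 'cV[R]_m -> R) (a : R).
Hypothesis ga : strongly_convex a gs.

Let a_gt0 : 0 < a. Proof. by case: ga. Qed.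

Let gr (y : 'cV[R]_m) := gs (b - y).

Let gr_sub : strongly_subdifferentiable a gr.
Proof.
move=> y; have [s sP] := strongly_convex_subdifferentiable ga (b - y).
exists (- s) => u; have := sP (b - u).
have -> : b - u - (b - y) = - (u - y) by rewrite !opprB addrC addrA subrK.
by rewrite l2normN innerNl innerNr.
Qed.

Let col_range_ker :
  col_range A = [set y | (1%:M - A *m (pinvmx A^T)^T) *m y = 0].
Proof.
apply/seteqP; split => y /=; rewrite mulmxBl mul1mx -mulmxA.
  by move=> /col_rangeP ->; rewrite subrr.
by move=> /subr0_eq yA; apply/col_rangeP.
Qed.

Lemma dual_minimizer :
  exists yhat, unique (minimizer (col_range A) gr) yhat.
Proof.
rewrite col_range_ker; apply: (strong_minimizer a_gt0 gr_sub).
exact: mulmx0.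
Qed.

Variable yhat : 'cV[R]_m.
Hypothesis yhat_min : minimizer (col_range A) gr yhat.

Definition dual_gap (zs : 'cV[R]_m) := gs zs - gs (b - yhat).

Lemma dual_gap_ge zs : col_range A (b - zs) ->
  l2norm (zs - (b - yhat)) ^+ 2 <= 4 / a * dual_gap zs.
Proof.
move=> bzs; have := yhat_min; rewrite col_range_ker => ymin.
have bzs' : (1%:M - A *m (pinvmx A^T)^T) *m (b - zs) = 0.
  by move: bzs; rewrite col_range_ker.
have := strong_minimizer_growth gr_sub ymin bzs'.
rewrite /gr /dual_gap subKr l2norm_distC.
have -> : yhat - (b - zs) = zs - (b - yhat) by rewrite !opprB addrCA.
by rewrite -(invf_div a) => h; rewrite ler_pdivlMl ?divr_gt0.
Qed.

Lemma dual_gap_ge0 zs : col_range A (b - zs) -> 0 <= dual_gap zs.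
Proof.
by move=> bzs; rewrite subr_ge0; have := yhat_min.2 _ bzs; rewrite /gr subKr.
Qed.

Variable L : R.
Hypothesis L_gt0 : 0 < L.
Hypothesis gsL : lipschitz_gradient L gs.

(** The Polyak-Lojasiewicz inequality on the affine space [b + range A].  The
    displacement to the minimizer lies in [range A], so that only the component
    of the gradient seen by [A^T] matters. *)
Lemma dual_gap_le_gradient : exists2 K, 0 < K & forall zs,
  col_range A (b - zs) ->
  dual_gap zs <= K * l2norm (A^T *m gradient gs zs) ^+ 2.
Proof.
have [c c0 cA] := col_range_preimage A.
exists (c ^+ 2 / (2 * a)); first by rewrite divr_gt0 ?exprn_gt0 ?mulr_gt0.
move=> zs bzs; set z := gradient gs zs; have [_ gc gS] := ga.
have zsub : subdiff gs zs z.
  have [s su] := subdiff_nonempty zs gc.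
  by rewrite /z (gradient_subdiff (gsL.1 zs) su).
have [u uE uc] := cA _ (col_rangeB bzs yhat_min.1).
have dE : b - yhat - zs = b - zs - yhat by rewrite addrAC.
have := gS zs (b - yhat) z zsub.
rewrite /dual_gap dE -uE inner_mulmx uE.
have c2 : 0 < a / c ^+ 2 by rewrite divr_gt0 ?exprn_gt0.
have := inner_young (- (A^T *m z)) u c2; rewrite l2normN innerNl.
have : a / c ^+ 2 / 2 * l2norm u ^+ 2 <= a / 2 * l2norm (b - zs - yhat) ^+ 2.
  rewrite [a / _ / _]mulrAC -[leLHS]mulrA.
  rewrite ler_wpM2l ?divr_ge0 ?(ltW a_gt0)// mulrC.
  rewrite ler_pdivrMr ?exprn_gt0// -exprMn mulrC.
  by rewrite ler_pXn2r ?nnegrE ?mulr_ge0 ?l2norm_ge0// ltW.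
have -> : c ^+ 2 / (2 * a) = (2 * (a / c ^+ 2))^-1.
  by field; rewrite !gt_eqF.
by lra.
Qed.

(** The step direction [B *m (B^T *m gradient)] has the squared norm of
    [B^T *m gradient] as its inner product with the gradient; a quarter of this
    first-order decrease survives the curvature. *)
Lemma dual_block_descent k (B : 'M[R]_(m, k)) zs : B != 0 ->
  gs (zs - 1 / (L * spectral_norm B ^+ 2) *: (B *m (B^T *m gradient gs zs))) <=
  gs zs - (4 * L * spectral_norm B ^+ 2)^-1 *
    l2norm (B^T *m gradient gs zs) ^+ 2.
Proof.
move=> /spectral_norm_gt0 B0; have [_ gc _] := ga.
set z := gradient gs zs; set t := 1 / _; set r := B^T *m z.
apply: (le_trans (lipschitz_gradient_descent zs _ gc gsL)).
rewrite [zs - _ - zs]addrAC subrr add0r -/z -scaleNr.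
rewrite innerZr inner_mulmx -/r -l2norm_sq.
rewrite l2normZ normrN exprMn real_normK ?num_real//.
have := spectral_norm_ge B r.
rewrite -(@ler_pXn2r _ 2) ?nnegrE ?mulr_ge0 ?l2norm_ge0 ?(ltW B0)// exprMn.
have c0 : 0 <= 3 / 4 * L * t ^+ 2.
  by rewrite mulr_ge0 ?sqr_ge0// mulr_ge0 ?ltW// divr_gt0.
move=> /(ler_wpM2l c0); rewrite /t.
set x := l2norm r ^+ 2; set y := l2norm _ ^+ 2.
have -> : 3 / 4 * L * (1 / (L * spectral_norm B ^+ 2)) ^+ 2 *
    (spectral_norm B ^+ 2 * x) = 3 / 4 * (1 / (L * spectral_norm B ^+ 2) * x).
  by field; rewrite !gt_eqF.
have -> : (4 * L * spectral_norm B ^+ 2)^-1 * x =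
   1 / 4 * (1 / (L * spectral_norm B ^+ 2) * x).
  by field; rewrite !gt_eqF.
by rewrite mulNr mulrA; lra.
Qed.

End dual.

(** * The Bregman distance of the primal iterates *)

Section primal.
Context {R : realType} {m n : nat}.
Variables (A : 'M[R]_(m, n)) (f : 'cV[R]_n -> R) (a : R).
Hypothesis fa : strongly_convex a f.
Variables (yhat : 'cV[R]_m) (xhat : 'cV[R]_n).
Hypothesis xhat_min : minimizer [set u | A *m u = yhat] f xhat.

Let a_gt0 : 0 < a. Proof. by case: fa. Qed.

(** The Bregman distance from the primal iterate to [xhat], written as a
    function of the dual variable alone: a step moves the dual variable
    linearly, and the conjugate is smooth. *)
Definition primal_gap (xs : 'cV[R]_n) :=
  conjugate f xs - inner xs xhat + f xhat.

Lemma primal_gapE x xs : subdiff f x xs -> primal_gap xs = bregman f x xs xhat.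
Proof.
move=> fx; rewrite /primal_gap /bregman (conjugate_subdiff fx).
by rewrite innerDr innerNr; lra.
Qed.

Lemma primal_gap_ge x xs : subdiff f x xs ->
  l2norm (x - xhat) ^+ 2 <= 2 / a * primal_gap xs.
Proof.
move=> fx; have [_ _ fS] := fa; have := fS x xhat xs fx.
rewrite (primal_gapE fx) /bregman l2norm_distC => h.
by rewrite -(invf_div a) ler_pdivlMl ?divr_gt0//; lra.
Qed.

Lemma primal_gap_ge0 xs : 0 <= primal_gap xs.
Proof.
have [x fx] := strong_subdiff_surj fa xs.
rewrite -(@pmulr_rge0 _ (2 / a)) ?divr_gt0//.
by apply: le_trans (primal_gap_ge fx); apply: sqr_ge0.
Qed.

(** A row-block step sees the consistent residual [B (x - xhat)] perturbed by
    the error [e] of the current right-hand side.  The cross terms cancel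
    exactly for this step length. *)
Lemma primal_block_step k (B : 'M[R]_(k, n)) x xs (e : 'cV[R]_k) :
  let t := 1 / (a^-1 * spectral_norm B ^+ 2) in
  B != 0 -> subdiff f x xs ->
  primal_gap (xs - t *: (B^T *m (B *m (x - xhat) - e))) <=
  primal_gap xs - t / 2 * l2norm (B *m (x - xhat)) ^+ 2
                + t / 2 * l2norm e ^+ 2.
Proof.
move=> t /spectral_norm_gt0 B0 fx.
set r := B *m (x - xhat) - e; set xs' := xs - _.
have t0 : 0 < t by rewrite divr_gt0// mulr_gt0 ?exprn_gt0 ?invr_gt0.
have dxs : xs' - xs = - t *: (B^T *m r).
  by rewrite /xs' addrAC subrr add0r scaleNr.
have := conjugate_smooth fa xs' fx; rewrite dxs.
have -> : inner x (- t *: (B^T *m r)) =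
    - t * inner r (B *m (x - xhat)) - t * inner (B^T *m r) xhat.
  rewrite inner_mulmx innerC !innerZl [inner _ (_ - _)]innerDr innerNr.
  by ring.
have -> : primal_gap xs' =
    conjugate f xs' - inner xs xhat + t * inner (B^T *m r) xhat + f xhat.
  by rewrite /primal_gap /xs' innerDl innerNl innerZl; ring.
have : (2 * a)^-1 * l2norm (- t *: (B^T *m r)) ^+ 2 <= t / 2 * l2norm r ^+ 2.
  rewrite l2normZ normrN exprMn real_normK ?num_real//.
  have := spectral_norm_tr_ge r B0.
  rewrite -(@ler_pXn2r _ 2) ?nnegrE ?mulr_ge0 ?l2norm_ge0 ?(ltW B0)// exprMn.
  have c0 : 0 <= (2 * a)^-1 * t ^+ 2.
    by rewrite mulr_ge0 ?sqr_ge0// invr_ge0 mulr_ge0// ltW.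
  move=> /(ler_wpM2l c0); rewrite -[in leLHS]mulrA => /le_trans; apply.
  rewrite le_eqVlt; apply/orP; left; apply/eqP; rewrite /t.
  by field; rewrite !gt_eqF.
rewrite /primal_gap.
have -> : l2norm r ^+ 2 = 2 * inner r (B *m (x - xhat)) -
    l2norm (B *m (x - xhat)) ^+ 2 + l2norm e ^+ 2.
  rewrite !l2norm_sq /r !inner_lin (innerC e); ring.
by lra.
Qed.

(** Linear growth of the subdifferential keeps the dual variable within a
    multiple of the square root of [1 + primal_gap], so that duality against
    the optimal multiplier bounds the gap by the residual, up to that factor. *)
Lemma primal_gap_growth : subdiff_linear_growth f ->
  exists2 K, 0 < K & forall x xs, subdiff f x xs -> col_range A^T xs ->
    primal_gap xs ^+ 2 <= K * (1 + primal_gap xs) * l2norm (A *m x - yhat) ^+ 2.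
Proof.
move=> [eta [rho [eta0 rho0 fgrow]]]; have [/= Axhat xmin] := xhat_min.
have [_ fc _] := fa.
have [s fs sA] : exists2 s, subdiff f xhat s & col_range A^T s.
  apply: subdiff_col_range => // v Av; apply: xmin.
  by rewrite /= mulmxDr Av addr0.
have [c c0 cA] := col_range_preimage A^T.
pose rho' := eta * l2norm xhat + rho + l2norm s.
exists (c ^+ 2 * (4 * eta ^+ 2 / a + 2 * rho' ^+ 2 + 1)).
  rewrite mulr_gt0 ?exprn_gt0// ltr_wpDl// addr_ge0//.
    by rewrite divr_ge0 ?(ltW a_gt0)// mulr_ge0// sqr_ge0.
  by rewrite mulr_ge0// sqr_ge0.
move=> x xs fx xsA; have [u uE uc] := cA _ (col_rangeB xsA sA).
have g0 := primal_gap_ge0 xs; have gx := primal_gap_ge fx.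
have xsb : l2norm (xs - s) ^+ 2 <=
    (4 * eta ^+ 2 / a + 2 * rho' ^+ 2 + 1) * (1 + primal_gap xs).
  have h1 : l2norm (xs - s) <= eta * l2norm (x - xhat) + rho'.
    have := l2norm_triangle xs (- s); rewrite l2normN.
    have := l2norm_triangle (x - xhat) xhat; rewrite subrK.
    move=> /(ler_wpM2l eta0); have := fgrow _ _ fx; rewrite /rho'; lra.
  have h2 : 0 <= eta * l2norm (x - xhat) by rewrite mulr_ge0 ?l2norm_ge0.
  have h3 : 0 <= rho' by rewrite !addr_ge0 ?mulr_ge0 ?l2norm_ge0.
  have : l2norm (xs - s) ^+ 2 <= (eta * l2norm (x - xhat) + rho') ^+ 2.
    by rewrite ler_pXn2r ?nnegrE ?l2norm_ge0// addr_ge0.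
  have : 2 * eta ^+ 2 * l2norm (x - xhat) ^+ 2 <=
      4 * eta ^+ 2 / a * primal_gap xs.
    have e2 : 0 <= 2 * eta ^+ 2 by rewrite mulr_ge0 ?sqr_ge0.
    by have := ler_wpM2l e2 gx; lra.
  have := sqr_ge0 (eta * l2norm (x - xhat) - rho').
  have : 0 <= 4 * eta ^+ 2 / a.
    by rewrite divr_ge0 ?(ltW a_gt0)// mulr_ge0// sqr_ge0.
  have : 0 <= rho' ^+ 2 * primal_gap xs by rewrite mulr_ge0 ?sqr_ge0.
  clearbody rho'; rewrite !sqrrD sqrrN exprMn.
  by move: (4 * eta ^+ 2 / a) => E; lra.
have gle : primal_gap xs <= c * l2norm (xs - s) * l2norm (A *m x - yhat).
  apply: (@le_trans _ _ (inner (xs - s) (x - xhat))).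
    rewrite (primal_gapE fx) /bregman; have := fs x.
    by rewrite !inner_lin; lra.
  rewrite -uE -inner_mulmx mulmxBr Axhat uE.
  apply: (le_trans (cauchy_schwarz _ _)).
  by rewrite ler_wpM2r ?l2norm_ge0.
have : primal_gap xs ^+ 2 <=
    (c * l2norm (xs - s) * l2norm (A *m x - yhat)) ^+ 2.
  by rewrite ler_pXn2r ?nnegrE// (le_trans g0).
move=> /le_trans; apply; rewrite !exprMn ler_wpM2r ?sqr_ge0// -mulrA.
by rewrite ler_wpM2l ?sqr_ge0.
Qed.

End primal.

(** * Recursive inequalities *)

Section recursions.
Context {R : realType}.
Implicit Types (d : nat -> R) (k : nat) (q : R).

Lemma linear_recursion d q B : 0 < q -> 0 <= B ->
  (forall k, d k.+1 <= q * d k + B * q ^+ k) ->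
  exists2 C, 0 < C & forall k, d k <= C * (1 + k%:R) * q ^+ k.
Proof.
move=> q0 B0 dq.
have dk k : d k <= (`|d 0| + B / q * k%:R) * q ^+ k.
  elim: k => [|k IH]; first by rewrite mulr0 addr0 expr0 mulr1 ler_norm.
  apply: (le_trans (dq k)); have := ler_wpM2l (ltW q0) IH.
  have -> : (`|d 0| + B / q * k.+1%:R) * q ^+ k.+1 =
      q * ((`|d 0| + B / q * k%:R) * q ^+ k) + B * q ^+ k.
    by rewrite -natr1 exprS; field; rewrite gt_eqF.
  by rewrite lerD2r.
have Bq : 0 <= B / q by rewrite divr_ge0// ltW.
exists (`|d 0| + B / q + 1); first by rewrite ltr_wpDl// addr_ge0.
move=> k; apply: (le_trans (dk k)).
rewrite ler_wpM2r ?exprn_ge0 ?(ltW q0)//.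
have k0 : 0 <= k%:R :> R by [].
by have := mulr_ge0 (normr_ge0 (d 0)) k0; lra.
Qed.

(** The left side is at most the partial sum of the geometric series. *)
Lemma geometric_mul_le q k : 0 < q < 1 ->
  (1 + k%:R) * q ^+ k <= (1 - q)^-1 :> R.
Proof.
move=> /andP[q0 q1]; have q1' : 0 < 1 - q by rewrite subr_gt0.
suff : (1 - q) * ((1 + k%:R) * q ^+ k) <= 1 - q ^+ k.+1.
  move=> h; rewrite -[leRHS]mulr1 ler_pdivlMl//; apply: (le_trans h).
  by rewrite gerBl exprn_ge0// ltW.
elim: k => [|k IH]; first by rewrite addr0 expr0 expr1 !mulr1.
rewrite -natr1 (exprS q k.+1).
have : q ^+ k.+1 * (1 - q) <= 1 * (1 - q).
  by rewrite ler_wpM2r ?(ltW q1')// exprn_ile1 ?(ltW q0) ?(ltW q1).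
have := ler_wpM2l (ltW q0) IH; rewrite exprS.
by move: (q ^+ k) => Q; lra.
Qed.

(** Writing [q] as the square of [r] leaves one factor [r ^ k] for each of the
    two factors [k + 1]. *)
Lemma geometric_le_inverse_square q : 0 < q < 1 ->
  exists2 G, 0 < G & forall k, q ^+ k <= G * k.+1%:R^-1 ^+ 2 :> R.
Proof.
move=> /andP[q0 q1]; set r := Num.sqrt q.
have r01 : 0 < r < 1.
  by rewrite sqrtr_gt0 q0/= -sqrtr1 ltr_sqrt.
have r1' : 0 < 1 - r by rewrite subr_gt0; case/andP: r01.
exists ((1 - r)^-1 ^+ 2); first by rewrite exprn_gt0// invr_gt0.
move=> k; have k0 : 0 < k.+1%:R :> R by [].
rewrite [k.+1%:R^-1 ^+ 2]exprVn ler_pdivlMr ?exprn_gt0//.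
rewrite -[q in q ^+ k](sqr_sqrtr (ltW q0)) -/r.
rewrite exprAC -exprMn.
rewrite ler_pXn2r ?nnegrE ?mulr_ge0 ?exprn_ge0 ?invr_ge0
  ?sqrtr_ge0 ?(ltW r1')//.
by rewrite mulrC -nat1r geometric_mul_le.
Qed.

(** The sequence is bounded, so [1 + d k] may be replaced by a constant; what
    remains is a discrete form of the differential equation [d' = - c d ^ 2],
    whose solutions decay like [1 / k].  For the step from [C / k] to
    [C / (k + 1)], either [d k] is below half of [C / k], or its square is large
    enough to pay for both the perturbation and the decrease of the bound. *)
Lemma quadratic_recursion d c B q : 0 < c -> 0 <= B -> 0 < q < 1 ->
  (forall k, 0 <= d k) ->
  (forall k, d k.+1 <= d k - c * (d k ^+ 2 / (1 + d k)) + B * q ^+ k) ->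
  exists2 C, 0 < C & forall k, d k <= C / k.+1%:R.
Proof.
move=> c0 B0 q01 d0 dq; have /andP[q0 q1] := q01.
have q1' : 0 < 1 - q by rewrite subr_gt0.
pose M := d 0 + B / (1 - q).
have Bq : 0 <= B / (1 - q) by rewrite divr_ge0// ltW.
have M0 : 0 <= M by rewrite addr_ge0.
have dM k : d k <= M.
  suff : d k <= d 0 + B / (1 - q) * (1 - q ^+ k).
    move=> /le_trans; apply; rewrite lerD2l ler_piMr//.
    by rewrite gerBl exprn_ge0// ltW.
  elim: k => [|k IH]; first by rewrite expr0 subrr mulr0 addr0.
  have -> : d 0 + B / (1 - q) * (1 - q ^+ k.+1) =
      d 0 + B / (1 - q) * (1 - q ^+ k) + B * q ^+ k.
    by rewrite exprS; field; rewrite gt_eqF.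
  apply: (le_trans (dq k)); rewrite lerD2r (le_trans _ IH)// gerBl.
  by rewrite mulr_ge0 ?(ltW c0)// divr_ge0 ?sqr_ge0// addr_ge0.
have [G G0 qG] := geometric_le_inverse_square q01.
pose c' := c / (1 + M); pose E := B * G.
have c'0 : 0 < c' by rewrite divr_gt0// ltr_wpDr.
have E0 : 0 <= E by rewrite mulr_ge0// ltW.
have {}dq k : d k.+1 <= d k - c' * d k ^+ 2 + E * k.+1%:R^-1 ^+ 2.
  apply: (le_trans (dq k)); rewrite lerD//; last first.
    by rewrite /E -mulrA ler_wpM2l.
  rewrite lerD2l lerN2 /c' -mulrA ler_wpM2l ?(ltW c0)// mulrC.
  by rewrite ler_wpM2l ?sqr_ge0// lef_pV2 ?posrE ?lerD2l// ltr_wpDr.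
(* The first summand serves the two initial indices, the others the two cases
   of the induction step. *)
pose C := 2 * M + 3 * E + 8 / c'.
have c8 : 0 < 8 / c' by rewrite divr_gt0.
have C0 : 0 < C by rewrite /C; move: (8 / c') c8 => X; lra.
have CE : C + E <= c' * C ^+ 2 / 4.
  have h8 : 8 <= c' * C.
    have -> : 8 = c' * (8 / c') by field; rewrite gt_eqF.
    by rewrite ler_wpM2l ?(ltW c'0)// /C; move: (8 / c') => X; lra.
  have /(ler_wpM2r (ltW C0)) := h8.
  have : E <= C by rewrite /C; move: (8 / c') c8 => X; lra.
  by rewrite expr2; lra.
have C3 : 3 * E <= C by rewrite /C; move: (8 / c') c8 => X; lra.
have C2 : M <= C / 2 by rewrite /C; move: (8 / c') c8 => X; lra.
exists C => //; elim=> [|[_|k]].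
- by apply: (le_trans (dM 0)); lra.
- exact: le_trans (dM _) C2.
set u := k.+2%:R^-1; move=> IH; have u0 : 0 < u by rewrite invr_gt0.
have u2 : u <= 1 / 2 by rewrite div1r lef_pV2 ?posrE// ler_nat.
set v := _^-1; have v0 : 0 < v by rewrite invr_gt0.
have uv : v = u - u * v.
  have : 0 < k.+2%:R :> R by [].
  rewrite /u /v -(@natr1 R k.+2); move: (k.+2%:R) => K K0.
  by field; rewrite !gt_eqF// ltr_wpDr.
have v2 : v * u <= v * (1 / 2) by rewrite ler_wpM2l// ltW.
apply: (le_trans (dq _)); rewrite -/u.
have [du|du] := leP (d k.+1) (C * u / 2).
  have h1 : 0 <= c' * d k.+1 ^+ 2 by rewrite mulr_ge0 ?sqr_ge0// ltW.
  have h2 : 3 * E * (u * u) <= C * (u * (1 / 2)).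
    have uu : u * u <= u * (1 / 2) by rewrite ler_wpM2l// ltW.
    by rewrite ler_pM// ?mulr_ge0// ltW.
  have h3 : C * (u - v / 2) <= C * v by rewrite ler_wpM2l ?(ltW C0)//; lra.
  by move: h1 h2 h3 du; rewrite expr2; move: (c' * _) => X; lra.
have h1 : (C * u / 2) ^+ 2 <= d k.+1 ^+ 2.
  by rewrite ler_pXn2r ?nnegrE ?(ltW du)// mulr_ge0// mulr_ge0// ltW.
have := ler_wpM2l (ltW c'0) h1.
have u20 : 0 <= u ^+ 2 by rewrite sqr_ge0.
have := ler_wpM2r u20 CE.
have : C * (u * v) <= C * (u * u).
  rewrite !ler_wpM2l ?ltW// uv gtrBl mulr_gt0//.
move: IH; rewrite -/u [in X in _ -> _ -> _ -> _ -> _ <= C * X]uv.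
by move: (d k.+1) => D; lra.
Qed.

End recursions.

(** * Mean values along a finitely driven random iteration *)

Section finite_families.
Context {R : realType} {I : finType}.

Lemma finite_lower_bound (v : I -> R) :
  (forall i, 0 < v i) -> exists2 c, 0 < c & forall i, c <= v i.
Proof.
move=> v0; have S0 : 0 <= \sum_i (v i)^-1.
  by rewrite sumr_ge0// => i _; rewrite invr_ge0 ltW.
exists (1 + \sum_i (v i)^-1)^-1; first by rewrite invr_gt0 ltr_wpDr.
move=> i; rewrite -[leRHS]invrK lef_pV2 ?posrE ?invr_gt0 ?ltr_wpDr//.
rewrite (bigD1 i)//= addrCA lerDl addr_ge0// sumr_ge0// => j _.
by rewrite invr_ge0 ltW.
Qed.

Lemma finite_upper_bound (v : I -> R) :
  exists2 c, 0 < c & forall i, v i <= c.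
Proof.
have S0 : 0 <= \sum_i `|v i| by rewrite sumr_ge0.
exists (1 + \sum_i `|v i|); first by rewrite ltr_wpDr.
move=> i; apply: (le_trans (ler_norm _)).
by rewrite (bigD1 i)//= addrCA lerDl addr_ge0// sumr_ge0.
Qed.

End finite_families.

Section mean.
Context {R : realType} {S : Type} {C : finType}.
Variables (w : C -> R) (step : S -> C -> S) (s0 : S).

(** The mean of [F] after [k] independent choices with weights [w], as the
    [k]-th iterate of the transition operator of the Markov chain.  The last
    choice is averaged first, which is how one-step inequalities enter. *)
Fixpoint mean k (F : S -> R) : R :=
  if k is k'.+1 then mean k' (fun s => \sum_c w c * F (step s c)) else F s0.

Hypotheses (w_ge0 : forall c, 0 <= w c) (w_sum : \sum_c w c = 1).

Lemma mean_lin k a (F G : S -> R) :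
  mean k (fun s => a * F s + G s) = a * mean k F + mean k G.
Proof.
elim: k F G => //= k IH F G; rewrite -IH; congr mean; apply/funext => s.
rewrite mulr_sumr -big_split; apply: eq_bigr => c _ /=.
by rewrite mulrDr mulrCA.
Qed.

Lemma meanZ k a (F : S -> R) : mean k (fun s => a * F s) = a * mean k F.
Proof.
elim: k F => //= k IH F; rewrite -IH; congr mean; apply/funext => s.
by rewrite mulr_sumr; apply: eq_bigr => c _; rewrite mulrCA.
Qed.

Lemma mean_sum k (I : Type) (r : seq I) (a : I -> R) (G : I -> S -> R) :
  mean k (fun s => \sum_(i <- r) a i * G i s) =
  \sum_(i <- r) a i * mean k (G i).
Proof.
elim: r => [|i r IH].
  rewrite big_nil; under eq_fun do rewrite big_nil.
  by elim: k => //= k IH; under eq_fun do rewrite -mulr_suml mulr0.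
by rewrite big_cons -IH -mean_lin; under eq_fun do rewrite big_cons.
Qed.

Lemma mean_cst k (a : R) : mean k (fun=> a) = a.
Proof.
by elim: k => //= k IH; rewrite -mulr_suml w_sum mul1r.
Qed.

(** Invariants may depend on time: the relation between the primal iterate and
    its dual variable only holds after the first step. *)
Lemma mean_le (inv : nat -> S -> Prop) k (F G : S -> R) :
  inv 0%N s0 -> (forall l s c, inv l s -> inv l.+1 (step s c)) ->
  (forall s, inv k s -> F s <= G s) -> mean k F <= mean k G.
Proof.
move=> inv0 invS; elim: k F G => [|k IH] F G FG /=; first exact: FG.
apply: IH => s sinv; apply: ler_sum => c _; rewrite ler_wpM2l//.
exact/FG/invS.
Qed.

End mean.

Section product_weights.
Context {R : realType} {I J : finType}.
Variables (p : I -> R) (q : J -> R).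

Lemma sum_product_fst (F : I -> R) : \sum_j q j = 1 ->
  \sum_(c : I * J) p c.1 * q c.2 * F c.1 = \sum_i p i * F i.
Proof.
move=> q1; rewrite -(pair_bigA _ (fun i j => p i * q j * F i))/=.
apply: eq_bigr => i _; rewrite -mulr_suml -mulr_sumr q1 mulr1//.
Qed.

Lemma sum_product_snd (F : J -> R) : \sum_i p i = 1 ->
  \sum_(c : I * J) p c.1 * q c.2 * F c.2 = \sum_j q j * F j.
Proof.
move=> p1; rewrite -(pair_bigA _ (fun i j => p i * q j * F j))/= exchange_big/=.
by apply: eq_bigr => j _; rewrite -!mulr_suml p1 mul1r.
Qed.

End product_weights.

(** * One step of the method in the mean *)

Section gerk_mean.
Context {R : realType} {Mr Nc : nat} {mi : 'I_Mr -> nat} {nj : 'I_Nc -> nat}.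
Variables (A : 'M[R]_(\sum_i mi i, \sum_j nj j)) (b : 'cV[R]_(\sum_i mi i)).
Variables (f : 'cV[R]_(\sum_j nj j) -> R) (gs : 'cV[R]_(\sum_i mi i) -> R).
Variables (alphaf alphag Lg : R) (p : 'I_Mr -> R) (pt : 'I_Nc -> R).
Hypotheses (A_row : forall i, submxcol A i != 0)
  (A_col : forall j, submxrow A j != 0).
Hypotheses (gs_conv : strongly_convex alphag gs) (Lg_gt0 : 0 < Lg)
  (gs_lip : lipschitz_gradient Lg gs) (f_conv : strongly_convex alphaf f).
Hypotheses (p_gt0 : forall i, 0 < p i) (p_sum : \sum_i p i = 1)
  (pt_gt0 : forall j, 0 < pt j) (pt_sum : \sum_j pt j = 1).
Variables (yhat : 'cV[R]_(\sum_i mi i)) (xhat : 'cV[R]_(\sum_j nj j)).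
Hypotheses (yhat_min : minimizer (col_range A) (fun y => gs (b - y)) yhat)
  (xhat_min : minimizer [set u | A *m u = yhat] f xhat).

Definition gerk_weight (c : 'I_Nc * 'I_Mr) := pt c.1 * p c.2.

Definition gerk_next s (c : 'I_Nc * 'I_Mr) :=
  gerk_step A b f gs alphaf^-1 Lg s c.1 c.2.

Lemma gerk_weight_ge0 c : 0 <= gerk_weight c.
Proof. by rewrite mulr_ge0 ?ltW. Qed.

Lemma gerk_weight_sum : \sum_c gerk_weight c = 1.
Proof.
have := sum_product_fst pt (fun=> 1) p_sum.
by under eq_bigr do rewrite mulr1; move=> ->; under eq_bigr do rewrite mulr1.
Qed.

Definition gerk_inv k (s : gerk_state) :=
  [/\ col_range A (b - gerk_zs s), gerk_z s = gradient gs (gerk_zs s),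
      col_range A^T (gerk_xs s) &
      (0 < k)%N -> gerk_x s = gradient (conjugate f) (gerk_xs s)].

Let col_range_move w u :
  col_range A (b - w) -> col_range A u -> col_range A (b - (w - u)).
Proof. by move=> bw uA; rewrite opprB addrCA; apply: col_rangeD. Qed.

Lemma gerk_inv_init : gerk_inv 0 (gerk_init b gs).
Proof.
split=> //=; first by rewrite subrr; exists 0; rewrite ?mulmx0.
by exists 0; rewrite ?mulmx0.
Qed.

Lemma gerk_inv_next k s c : gerk_inv k s -> gerk_inv k.+1 (gerk_next s c).
Proof.
move=> [bzs sz xsA _]; split=> //=.
  by apply/col_range_move/col_rangeZ/col_range_submxrow.
by apply/col_rangeB/col_rangeZ/col_range_tr_submxcol.
Qed.

Local Notation state := (@gerk_state R Mr Nc mi nj).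

Let gap (s : state) := dual_gap b gs yhat (gerk_zs s).
Let dist (s : state) := primal_gap f xhat (gerk_xs s).
Let res (s : state) := l2norm (A *m gerk_x s - yhat) ^+ 2.

(** The mean of the block decreases dominates a multiple of the full
    [l2norm (A^T *m z) ^+ 2], which the Polyak-Lojasiewicz inequality compares
    with the gap. *)
Lemma dual_contraction : exists2 q, 0 < q < 1 & forall k s, gerk_inv k s ->
  \sum_c gerk_weight c * gap (gerk_next s c) <= q * gap s.
Proof.
have [K K0 KP] := dual_gap_le_gradient gs_conv yhat_min gs_lip.
pose v j := pt j * (4 * Lg * spectral_norm (submxrow A j) ^+ 2)^-1.
have v0 j : 0 < v j.
  rewrite mulr_gt0// invr_gt0 mulr_gt0 ?exprn_gt0 ?spectral_norm_gt0//.
  by rewrite mulr_gt0.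
have [c0 c00 vc] := finite_lower_bound v0.
(* The maximum with 1/2 only keeps the rate positive. *)
exists (Num.max (1 / 2) (1 - c0 / K)).
  rewrite lt_max gt_max; apply/andP; split; first by apply/orP; left; lra.
  by rewrite ltrBlDr ltrDl divr_gt0// andbT; lra.
move=> k s [bzs sz _ _].
have gap0 : 0 <= gap s by apply: (dual_gap_ge0 yhat_min).
apply: (@le_trans _ _ ((1 - c0 / K) * gap s)); last first.
  by rewrite ler_wpM2r// le_max lexx orbT.
set z := gradient gs (gerk_zs s).
pose N j := l2norm ((submxrow A j)^T *m z) ^+ 2.
pose g j := gap s - (4 * Lg * spectral_norm (submxrow A j) ^+ 2)^-1 * N j.
apply: (@le_trans _ _ (\sum_c gerk_weight c * g c.1)).
  apply: ler_sum => c _; rewrite ler_wpM2l ?gerk_weight_ge0//.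
  have := dual_block_descent gs_conv Lg_gt0 gs_lip (gerk_zs s) (A_col c.1).
  by rewrite /gap /dual_gap /= sz /g /N -/z /gap /dual_gap; lra.
rewrite (sum_product_fst pt g p_sum).
under eq_bigr => j _ do rewrite /g mulrBr mulrA -/(v j).
rewrite sumrB -mulr_suml pt_sum mul1r mulrBl mul1r lerD2l lerN2.
apply: (@le_trans _ _ (c0 * l2norm (A^T *m z) ^+ 2)).
  have := KP _ bzs; rewrite -/(gap s) -/z => /(ler_wpM2l (ltW c00)) h.
  by rewrite mulrAC ler_pdivrMr// (le_trans h)// mulrAC mulrA.
rewrite l2norm_submxcol mulr_sumr; apply: ler_sum => j _.
by rewrite /N tr_submxrow submxcol_mul ler_wpM2r ?sqr_ge0.
Qed.

(** Averaging over the rows reassembles the residual from its blocks, and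
    averaging over the columns turns the right-hand side errors into the dual
    gap. *)
Lemma primal_recursion : exists c1 c2, [/\ 0 < c1, 0 < c2 &
  forall k s, gerk_inv k.+1 s ->
    \sum_c gerk_weight c * dist (gerk_next s c) <=
      dist s - c1 * res s + c2 * gap s].
Proof.
have [q /andP[q0 q1] qP] := dual_contraction.
have ga0 : 0 < alphag by case: gs_conv.
have fa0 : 0 < alphaf by case: f_conv.
pose t i := 1 / (alphaf^-1 * spectral_norm (submxcol A i) ^+ 2).
have t0 i : 0 < t i.
  by rewrite divr_gt0// mulr_gt0 ?invr_gt0// exprn_gt0// spectral_norm_gt0.
have [c1 c10 c1P] : exists2 c, 0 < c & forall i, c <= p i * (t i / 2).
  by apply: finite_lower_bound => i; rewrite mulr_gt0// divr_gt0.
have [c2 c20 c2P] := finite_upper_bound (fun i => p i * (t i / 2)).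
exists c1, (c2 * (4 / alphag)); split=> //.
  by rewrite mulr_gt0// divr_gt0.
move=> k s sinv; have [bzs sz xsA /(_ isT) sx] := sinv.
have fx : subdiff f (gerk_x s) (gerk_xs s).
  by rewrite sx; apply: subdiff_gradient_conjugate f_conv _.
have [/= Axhat _] := xhat_min.
pose zs j := gerk_zs s - 1 / (Lg * spectral_norm (submxrow A j) ^+ 2) *:
  (submxrow A j *m ((submxrow A j)^T *m gerk_z s)).
(* The row step after column [j] works with the right-hand side [b - zs j]. *)
pose e j := b - zs j - yhat.
pose N i := l2norm (submxcol (A *m gerk_x s - yhat) i) ^+ 2.
pose G i := dist s - t i / 2 * N i.
pose E j i := t i / 2 * l2norm (submxcol (e j) i) ^+ 2.
have step c : dist (gerk_next s c) <= G c.2 + E c.1 c.2.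
  have := primal_block_step f_conv xhat (submxcol (e c.1) c.2) (A_row c.2) fx.
  have -> : submxcol A c.2 *m (gerk_x s - xhat) =
      submxcol (A *m gerk_x s - yhat) c.2.
    by rewrite submxcol_mul mulmxBr Axhat.
  rewrite -submxcolB /dist /= -/(zs _) submxcol_mul -submxcolB -submxcolD.
  have -> : A *m gerk_x s - yhat - e c.1 = A *m gerk_x s - b + zs c.1.
    by rewrite /e; apply/colP => l; rewrite !mxE; ring.
  by rewrite -/(t _) /G /E /dist.
apply: (@le_trans _ _ (\sum_c (gerk_weight c * G c.2 +
    gerk_weight c * E c.1 c.2))).
  by apply: ler_sum => c _; rewrite -mulrDr ler_wpM2l ?gerk_weight_ge0.
rewrite big_split/=; apply: lerD.
  rewrite (sum_product_snd p G pt_sum).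
  under eq_bigr => i _ do rewrite /G mulrBr mulrA.
  rewrite sumrB -mulr_suml p_sum mul1r lerD2l lerN2 /res l2norm_submxcol.
  by rewrite mulr_sumr; apply: ler_sum => i _; rewrite ler_wpM2r ?sqr_ge0.
have gap0 : 0 <= gap s by apply: (dual_gap_ge0 yhat_min).
apply: (@le_trans _ _ (c2 * (4 / alphag) * (q * gap s))); last first.
  rewrite ler_wpM2l ?ler_piMl ?(ltW q1)// mulr_ge0 ?(ltW c20)//.
  by rewrite divr_ge0// ltW.
apply: (@le_trans _ _ (c2 * (4 / alphag) *
    \sum_c gerk_weight c * gap (gerk_next s c))); last first.
  rewrite ler_wpM2l ?(qP k.+1)// mulr_ge0 ?(ltW c20)//.
  by rewrite divr_ge0// ltW.
rewrite (sum_product_fst pt (fun j => dual_gap b gs yhat (zs j)) p_sum).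
rewrite -(pair_bigA _ (fun j i => pt j * p i * E j i))/= mulr_sumr.
apply: ler_sum => j _; under eq_bigr do rewrite -mulrA.
rewrite -mulr_sumr mulrCA ler_wpM2l ?(ltW (pt_gt0 _))//.
have bzsj : col_range A (b - zs j).
  by apply/col_range_move/col_rangeZ/col_range_submxrow.
have := dual_gap_ge gs_conv yhat_min bzsj.
have -> : zs j - (b - yhat) = - e j by rewrite /e !opprB addrCA.
rewrite l2normN l2norm_submxcol => /(ler_wpM2l (ltW c20)).
rewrite [c2 * (_ * dual_gap _ _ _ _)]mulrA; apply: le_trans.
rewrite mulr_sumr; apply: ler_sum => i _.
by rewrite mulrA ler_wpM2r ?sqr_ge0.
Qed.

End gerk_mean.

(** * Expectations as mean values *)

Section random_iteration.
Context {R : realType} {S : Type} {C : finType}.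
Context {d : measure_display} {T : measurableType d}.
Variables (P : probability T R) (w : C -> R) (step : S -> C -> S) (s0 : S).
Variable X : nat -> T -> C.

Fixpoint cylinder l (cs : seq C) : set T :=
  if cs is c :: cs' then X l @^-1` [set c] `&` cylinder l.+1 cs' else setT.

Lemma cylinderP c0 l cs : cylinder l cs =
  [set t | forall i, (i < size cs)%N -> X (l + i) t = nth c0 cs i].
Proof.
elim: cs l => [|c cs IH] l /=; first by apply/seteqP; split.
rewrite IH; apply/seteqP; split => t /=.
  by move=> [Xl Xcs] [|i] /= ics; rewrite ?addn0// addnS -addSn Xcs.
move=> Xcs; split; first by have := Xcs 0%N isT; rewrite addn0.
by move=> i ics; have := Xcs i.+1 ics; rewrite addnS -addSn.
Qed.

Fixpoint run k (t : T) : S :=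
  if k is k'.+1 then step (run k' t) (X k' t) else s0.

Hypothesis X_meas : forall k c, measurable (X k @^-1` [set c]).
Hypothesis X_law : forall cs, P (cylinder 0 cs) = (\prod_(c <- cs) w c)%:E.

Lemma measurable_cylinder l cs : measurable (cylinder l cs).
Proof.
by elim: cs l => [|c cs IH] l //=; apply: measurableI.
Qed.

Lemma measurable_run k (B : set S) : measurable (run k @^-1` B).
Proof.
elim: k B => [|k IH] B.
  by rewrite /run preimage_cst; case: ifP.
have -> : run k.+1 @^-1` B = \big[setU/set0]_(c <- index_enum C)
    (X k @^-1` [set c] `&` run k @^-1` [set s | B (step s c)]).
  apply/seteqP; split => t /=.
    move=> Bt; rewrite -bigcup_seq; exists (X k t) => //=.
    by rewrite mem_index_enum.
  by rewrite -bigcup_seq => -[c _ [/= -> ]].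
by apply: bigsetU_measurable => c _; apply: measurableI.
Qed.

(** Conditioning on a finite stretch of the future choices turns the
    independence of the choices into an induction on time. *)
Lemma integral_run k (F : S -> R) cs : (forall s, 0 <= F s) ->
  (\int[P]_(t in cylinder k cs) (F (run k t))%:E =
     ((\prod_(c <- cs) w c) * mean w step s0 k F)%:E)%E.
Proof.
elim: k F cs => [|k IH] F cs F0.
  rewrite /= integral_cst; last exact: measurable_cylinder.
  by rewrite EFinM muleC; congr (_ * _)%E; apply: X_law.
pose D c := cylinder k (c :: cs).
have DE : cylinder k.+1 cs = \big[setU/set0]_(c <- index_enum C) D c.
  rewrite -bigcup_seq; apply/seteqP; split => t /=.
    by move=> ct; exists (X k t); rewrite /= ?mem_index_enum.
  by move=> [c _ []].
have mF : measurable_fun [set: T] (fun t => F (run k.+1 t)).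
  move=> _ B mB; rewrite setTI.
  exact: (measurable_run k.+1 (F @^-1` B)).
rewrite DE ge0_integral_bigsetU//=; first last.
- by move=> t _; rewrite lee_fin.
- by apply/measurable_EFinP; apply: measurable_funS mF.
- by move=> c c' _ _ [t [/= [<- _] [<- _]]].
- exact: index_enum_uniq.
- by move=> c; apply: measurable_cylinder.
have DcE c : (\int[P]_(t in D c) (F (step (run k t) (X k t)))%:E =
    (\prod_(c <- cs) w c * (w c * mean w step s0 k (F \o step^~ c)))%:E)%E.
  transitivity (\int[P]_(t in D c) ((F \o step^~ c) (run k t))%:E)%E.
    by apply: eq_integral => t; rewrite inE => -[/= -> _].
  rewrite (IH _ (c :: cs)); last by move=> s; apply: F0.
  by rewrite big_cons mulrCA mulrA.
under eq_bigr do rewrite DcE.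
by rewrite sumEFin -mulr_sumr -mean_sum.
Qed.

Lemma expectation_run k (F : S -> R) : (forall s, 0 <= F s) ->
  ('E_P[fun t => F (run k t)] = (mean w step s0 k F)%:E)%E.
Proof.
by move=> F0; rewrite unlock (integral_run k [::] F0) big_nil mul1r.
Qed.

End random_iteration.

Section gerk_cylinders.
Context {R : realType} {Mr Nc : nat}.
Context {d : measure_display} {T : measurableType d}.
Variables (P : probability T R) (p : 'I_Mr -> R) (pt : 'I_Nc -> R).
Variables (J : nat -> T -> 'I_Nc) (I : nat -> T -> 'I_Mr).
Hypothesis hIJ : gerk_choices P p pt J I.

Definition choice_pair k (t : T) := (J k t, I k t).

Lemma measurable_choice_pair k c : measurable (choice_pair k @^-1` [set c]).
Proof.
have [hJ hI _] := hIJ.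
have -> : choice_pair k @^-1` [set c] =
    J k @^-1` [set c.1] `&` I k @^-1` [set c.2].
  apply/seteqP; split => t /=; first by rewrite /choice_pair => <-.
  by rewrite /choice_pair => -[-> ->]; case: c.
by apply: measurableI; [have [] := hJ k c.1|have [] := hI k c.2].
Qed.

Lemma choice_pair_law cs : P (cylinder choice_pair 0 cs) =
  (\prod_(c <- cs) gerk_weight p pt c)%:E.
Proof.
case: cs => [|c0 cs']; first by rewrite big_nil/= probability_setT.
move: (c0 :: cs') => {cs'} cs; set n := size cs.
have [hJ hI hind] := hIJ.
pose s := map (@inl nat nat) (iota 0 n) ++ map (@inr nat nat) (iota 0 n).
have s_uniq : uniq s.
  rewrite cat_uniq !map_inj_uniq ?iota_uniq; do ?by move=> ? ? [].
  by rewrite andbT; apply/hasPn => _ /mapP[i _ ->]; apply/negP => /mapP[].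
pose E (a : nat + nat) := match a with
  | inl k => J k @^-1` [set (nth c0 cs k).1]
  | inr k => I k @^-1` [set (nth c0 cs k).2] end.
pose v (a : nat + nat) := match a with
  | inl k => pt (nth c0 cs k).1
  | inr k => p (nth c0 cs k).2 end.
have PE a : P (E a) = (v a)%:E.
  case: a => k; first by have [_] := hJ k (nth c0 cs k).1.
  by have [_] := hI k (nth c0 cs k).2.
have sE a : (a \in [fset a in s]%fset) = (a \in s).
  by rewrite !inE mem_cat.
have -> : cylinder choice_pair 0 cs =
    \bigcap_(a in [set` [fset a in s]%fset]) E a.
  rewrite (cylinderP _ c0); apply/seteqP; split => t /=.
    move=> tcs a /=; rewrite sE mem_cat => /orP[] /mapP[k].
      rewrite mem_iota => /= /tcs; rewrite add0n /choice_pair => kE ->.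
      by rewrite /= -kE.
    rewrite mem_iota => /= /tcs; rewrite add0n /choice_pair => kE ->.
    by rewrite /= -kE.
  move=> tE k kn; rewrite add0n /choice_pair.
  have := tE (inl k); have := tE (inr k); rewrite /= !sE !mem_cat.
  rewrite !map_f ?mem_iota// ?orbT => /(_ isT) -> /(_ isT) ->.
  by rewrite -surjective_pairing.
rewrite hind; last by case=> k _ /=; eexists.
rewrite (eq_bigr _ (fun a _ => PE a)) prodEFin; congr EFin.
rewrite (perm_big s)/=; last first.
  by apply: uniq_perm => //; exact: fset_uniq.
rewrite big_cat/= !big_map -big_split/= (big_nth c0) /index_iota subn0.
exact: eq_bigr.
Qed.

End gerk_cylinders.

(** * Rates of convergence *)

Section gerk_rates.
Context {R : realType} {Mr Nc : nat} {mi : 'I_Mr -> nat} {nj : 'I_Nc -> nat}.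
Variables (A : 'M[R]_(\sum_i mi i, \sum_j nj j)) (b : 'cV[R]_(\sum_i mi i)).
Variables (f : 'cV[R]_(\sum_j nj j) -> R) (gs : 'cV[R]_(\sum_i mi i) -> R).
Variables (alphaf alphag Lg : R) (p : 'I_Mr -> R) (pt : 'I_Nc -> R).
Hypotheses (A_row : forall i, submxcol A i != 0)
  (A_col : forall j, submxrow A j != 0).
Hypotheses (gs_conv : strongly_convex alphag gs) (Lg_gt0 : 0 < Lg)
  (gs_lip : lipschitz_gradient Lg gs) (f_conv : strongly_convex alphaf f).
Hypotheses (p_gt0 : forall i, 0 < p i) (p_sum : \sum_i p i = 1)
  (pt_gt0 : forall j, 0 < pt j) (pt_sum : \sum_j pt j = 1).
Variables (yhat : 'cV[R]_(\sum_i mi i)) (xhat : 'cV[R]_(\sum_j nj j)).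
Hypotheses (yhat_min : minimizer (col_range A) (fun y => gs (b - y)) yhat)
  (xhat_min : minimizer [set u | A *m u = yhat] f xhat).

Local Notation state := (@gerk_state R Mr Nc mi nj).

Definition gerk_mean :=
  mean (gerk_weight p pt) (gerk_next A b f gs alphaf Lg) (gerk_init b gs).

Let gap (s : state) := dual_gap b gs yhat (gerk_zs s).
Let dist (s : state) := primal_gap f xhat (gerk_xs s).
Let res (s : state) := l2norm (A *m gerk_x s - yhat) ^+ 2.
Let dual_error (s : state) := l2norm (gerk_zs s - (b - yhat)) ^+ 2.
Let primal_error (s : state) := l2norm (gerk_x s - xhat) ^+ 2.

Let alphag_gt0 : 0 < alphag. Proof. by case: gs_conv. Qed.
Let alphaf_gt0 : 0 < alphaf. Proof. by case: f_conv. Qed.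

Let gmean_le k F G : (forall s, gerk_inv A b f gs k s -> F s <= G s) ->
  gerk_mean k F <= gerk_mean k G.
Proof.
apply: mean_le; first exact: gerk_weight_ge0.
  exact: gerk_inv_init.
by move=> l s c; apply: gerk_inv_next.
Qed.

Let gmean_next k F G :
  (forall s, gerk_inv A b f gs k s -> \sum_c gerk_weight p pt c *
     F (gerk_next A b f gs alphaf Lg s c) <= G s) ->
  gerk_mean k.+1 F <= gerk_mean k G.
Proof. exact: gmean_le. Qed.

Let gap_decay : exists2 q, 0 < q < 1 & exists2 c, 0 < c &
  forall k, gerk_mean k gap <= c * q ^+ k.
Proof.
have [q q01 qP] := dual_contraction f alphaf A_col gs_conv Lg_gt0 gs_lip
  p_gt0 p_sum pt_gt0 pt_sum yhat_min.
have q0 : 0 < q by case/andP: q01.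
exists q => //; exists (`|gap (gerk_init b gs)| + 1); first by rewrite ltr_wpDl.
elim=> [|k IH]; first by rewrite expr0 mulr1 (le_trans (ler_norm _))// lerDl.
apply: (@le_trans _ _ (gerk_mean k (fun s => q * gap s))).
  by apply: gmean_next => s; apply: qP.
by rewrite /gerk_mean meanZ exprS mulrCA ler_wpM2l// ltW.
Qed.

Lemma dual_rate : exists2 q, 0 < q < 1 & exists2 c, 0 < c &
  forall k, gerk_mean k dual_error <= c * q ^+ k.
Proof.
have [q q01 [c c0 cP]] := gap_decay; exists q => //.
exists (4 / alphag * c); first by rewrite mulr_gt0// divr_gt0.
move=> k; apply: (@le_trans _ _ (gerk_mean k (fun s => 4 / alphag * gap s))).
  by apply: gmean_le => s [bzs _ _ _]; apply: (dual_gap_ge gs_conv yhat_min).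
rewrite /gerk_mean meanZ -[leRHS]mulrA ler_wpM2l ?cP//.
by rewrite divr_ge0// ltW.
Qed.

Let inv_subdiff k s : gerk_inv A b f gs k.+1 s ->
  subdiff f (gerk_x s) (gerk_xs s) /\ col_range A^T (gerk_xs s).
Proof.
move=> [_ _ xsA ->//]; split=> //.
exact: subdiff_gradient_conjugate f_conv _.
Qed.

Let dist_ge0 k : 0 <= gerk_mean k dist.
Proof.
have -> : 0 = gerk_mean k (fun=> 0).
  by rewrite /gerk_mean mean_cst//; apply: gerk_weight_sum.
by apply: gmean_le => s _; apply: (primal_gap_ge0 f_conv).
Qed.

(** The recursion starts after the first step because the initial primal
    iterate is the zero vector, which need not be the gradient of the conjugate
    at zero. *)
Let dist_recursion : exists c B q, [/\ 0 < c, 0 <= B, 0 < q < 1 & forall k,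
  gerk_mean k.+2 dist <=
    gerk_mean k.+1 dist - c * gerk_mean k.+1 res + B * q ^+ k].
Proof.
have [q q01 [g g0 gP]] := gap_decay; have /andP[q0 q1] := q01.
have [c1 [c2 [c10 c20 cP]]] := primal_recursion A_row A_col gs_conv Lg_gt0
  gs_lip f_conv p_gt0 p_sum pt_gt0 pt_sum yhat_min xhat_min.
exists c1, (c2 * g), q; split=> // [|k]; first by rewrite mulr_ge0// ltW.
apply: (@le_trans _ _ (gerk_mean k.+1
    (fun s => c2 * gap s + (- c1 * res s + dist s)))).
  by apply: gmean_next => s /cP; rewrite -/(dist s) -/(res s) -/(gap s); lra.
rewrite /gerk_mean !mean_lin -/gerk_mean mulNr addrC.
rewrite [_ + gerk_mean _ dist]addrC.
rewrite lerD2l -[leRHS]mulrA ler_wpM2l ?(ltW c20)// (le_trans (gP k.+1))//.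
by rewrite exprS ler_wpM2l ?(ltW g0)// ler_piMl ?exprn_ge0 ?ltW.
Qed.

Let primal_error_le k :
  gerk_mean k.+1 primal_error <= 2 / alphaf * gerk_mean k.+1 dist.
Proof.
rewrite /gerk_mean -meanZ; apply: gmean_le => s /inv_subdiff[fx _].
exact: (primal_gap_ge f_conv).
Qed.

(** The quadratic lower bound on the residual passes to the mean through the
    tangent of the convex function [x ^ 2 / (1 + x)] at the mean. *)
Lemma primal_rate_growth : subdiff_linear_growth f ->
  exists2 c, 0 < c & forall k, (0 < k)%N ->
    gerk_mean k primal_error <= c / k%:R.
Proof.
move=> fgrow.
have [K K0 KP] := primal_gap_growth f_conv xhat_min fgrow.
have [c [B [q [c0 B0 q01 dP]]]] := dist_recursion.
pose d k := gerk_mean k.+1 dist.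
have [|//|//|k|k|C C0 CP] := @quadratic_recursion R d (c / K) B q.
- by rewrite divr_gt0.
- exact: dist_ge0.
- apply: (le_trans (dP k)); rewrite lerD2r -/(d k) lerD2l lerN2.
  rewrite -mulrA ler_wpM2l ?(ltW c0)// ler_pdivrMl//.
  have D0 : 0 < 1 + d k by rewrite ltr_wpDr// dist_ge0.
  (* In terms of [u], the tangent of [x ^ 2 / (1 + x)] at [d k] is the affine
     function [(1 - u ^ 2) * x + (2 * u - 1 - u ^ 2)]. *)
  pose u := (1 + d k)^-1.
  apply: (@le_trans _ _ (gerk_mean k.+1
      (fun s => (1 - u ^+ 2) * dist s + (2 * u - 1 - u ^+ 2)))).
    rewrite /gerk_mean mean_lin mean_cst; last exact: gerk_weight_sum.
    rewrite -/gerk_mean -/(d k) /u le_eqVlt; apply/orP; left; apply/eqP.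
    by field; rewrite gt_eqF.
  rewrite /gerk_mean -meanZ -/gerk_mean.
  apply: gmean_le => s /inv_subdiff[fx xsA].
  have y0 : 0 < 1 + dist s by rewrite ltr_wpDr// (primal_gap_ge0 f_conv).
  rewrite -(ler_pM2l y0); have := KP _ _ fx xsA; rewrite -/(dist s) -/(res s).
  by have := sqr_ge0 (1 - u * (1 + dist s)); lra.
exists (2 / alphaf * C); first by rewrite mulr_gt0// divr_gt0.
case=> // k _; apply: (le_trans (primal_error_le k)).
by rewrite -[leRHS]mulrA ler_wpM2l ?CP// divr_ge0// ltW.
Qed.

Lemma primal_rate_error_bound : global_error_bound A f xhat yhat ->
  exists2 q, 0 < q < 1 & exists2 c, 0 < c & forall k,
    gerk_mean k primal_error <= c * (1 + k%:R) * q ^+ k.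
Proof.
move=> [gamma gamma0 gammaP].
have [c [B [q [c0 B0 /andP[q0 q1] dP]]]] := dist_recursion.
pose d k := gerk_mean k.+1 dist.
pose r := Num.max q (1 - c / gamma).
have r0 : 0 < r by rewrite lt_max q0.
have r1 : r < 1 by rewrite gt_max q1/= ltrBlDr ltrDl divr_gt0.
have d_res k : d k <= gamma * gerk_mean k.+1 res.
  rewrite /gerk_mean -meanZ; apply: gmean_le => s /inv_subdiff[fx xsA].
  by rewrite /dist (primal_gapE _ fx); apply: gammaP.
have [k|C C0 CP] := @linear_recursion R d r B r0 B0.
  have qr : q ^+ k <= r ^+ k.
    by rewrite lerXn2r ?nnegrE ?(ltW q0) ?(ltW r0)// /r le_max lexx.
  apply: (le_trans (dP k)); apply: lerD; last exact: ler_wpM2l.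
  apply: (@le_trans _ _ ((1 - c / gamma) * d k)); last first.
    by rewrite ler_wpM2r ?dist_ge0// /r le_max lexx orbT.
  rewrite mulrBl mul1r lerD2l lerN2 mulrAC ler_pdivrMr//.
  by rewrite -mulrA ler_wpM2l ?(ltW c0)// mulrC.
exists r; first by rewrite r0.
pose e0 := primal_error (gerk_init b gs).
have e00 : 0 <= e0 by apply: sqr_ge0.
have a2 : 0 < 2 / alphaf by rewrite divr_gt0.
exists (e0 + 2 / alphaf * C / r).
  by rewrite ltr_wpDl// divr_gt0// mulr_gt0.
case=> [|k].
  rewrite expr0 addr0 !mulr1 lerDl.
  by rewrite divr_ge0 ?(ltW r0)// mulr_ge0 ?(ltW a2) ?(ltW C0).
apply: (le_trans (primal_error_le k)).
apply: (le_trans (ler_wpM2l (ltW a2) (CP k))).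
apply: (@le_trans _ _ (2 / alphaf * C / r * (1 + k.+1%:R) * r ^+ k.+1)).
  have -> : 2 / alphaf * C / r * (1 + k.+1%:R) * r ^+ k.+1 =
      2 / alphaf * (C * (1 + k.+1%:R) * r ^+ k).
    by rewrite exprS; field; rewrite !gt_eqF.
  rewrite ler_wpM2l ?(ltW a2)// ler_wpM2r ?exprn_ge0 ?(ltW r0)//.
  by rewrite ler_wpM2l ?(ltW C0)// lerD2l ler_nat.
rewrite -[leLHS]mulrA -[leRHS]mulrA ler_wpM2r ?lerDr//.
by rewrite mulr_ge0 ?exprn_ge0 ?(ltW r0).
Qed.

End gerk_rates.

Lemma cvg_in_expectation_squeeze {R : realType} {d : measure_display}
    {T : measurableType d} (P : probability T R) n
    (X : nat -> T -> 'cV[R]_n) x (e : nat -> R) :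
  e @ \oo --> 0 ->
  (\forall k \near \oo, (mean_sq_error P (X k) x <= (e k)%:E)%E) ->
  cvg_in_expectation P X x.
Proof.
move=> e0 eX; rewrite /cvg_in_expectation.
apply: (@squeeze_cvge _ _ _ _ (cst 0%E) _ (EFin \o e)).
- apply: filterS eX => k eX; rewrite eX andbT.
  by apply: expectation_ge0 => t; exact: sqr_ge0.
- exact: cvg_cst.
- by apply: cvg_EFin => //; exact: nearW.
Qed.

Theorem theorem4p2 (R : realType) (Mr Nc : nat)
    (mi : 'I_Mr -> nat) (nj : 'I_Nc -> nat)
    (A : 'M[R]_(\sum_i mi i, \sum_j nj j))
    (b : 'cV[R]_(\sum_i mi i))
    (f : 'cV[R]_(\sum_j nj j) -> R) (gs : 'cV[R]_(\sum_i mi i) -> R)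
    (alphaf alphag Lg : R)
    (p : 'I_Mr -> R) (pt : 'I_Nc -> R)
    (d : measure_display) (T : measurableType d) (P : probability T R)
    (J : nat -> T -> 'I_Nc) (I : nat -> T -> 'I_Mr)
    (hAi : forall i, submxcol A i != 0)
    (hAj : forall j, submxrow A j != 0)
    (hgs : strongly_convex alphag gs)
    (hLg : 0 < Lg) (hgsL : lipschitz_gradient Lg gs)
    (hf : strongly_convex alphaf f)
    (hp : forall i, 0 < p i) (hp1 : \sum_i p i = 1)
    (hpt : forall j, 0 < pt j) (hpt1 : \sum_j pt j = 1)
    (hIJ : gerk_choices P p pt J I) :
  let iter k w := gerk A b f gs alphaf^-1 Lg (J^~ w) (I^~ w) k in
  let zs k w := gerk_zs (iter k w) in
  let x k w := gerk_x (iter k w) in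
  exists (yhat : 'cV[R]_(\sum_i mi i)) (xhat : 'cV[R]_(\sum_j nj j)),
    [/\ unique (minimizer (col_range A) (fun y => gs (b - y))) yhat,
        unique (minimizer [set u | A *m u = yhat] f) xhat,
        cvg_in_expectation P zs (b - yhat),
        subdiff_linear_growth f -> cvg_in_expectation P x xhat &
        exists q c : R,
          [/\ 0 < q < 1, 0 < c,
              forall k, (mean_sq_error P (zs k) (b - yhat)
                           <= (c * q ^+ k)%:E)%E &
              subdiff_linear_growth f ->
                (forall k, (0 < k)%N ->
                  (mean_sq_error P (x k) xhat <= (c / k%:R)%:E)%E) /\
                (global_error_bound A f xhat yhat ->
                  forall k, (mean_sq_error P (x k) xhat
                               <= (c * (1 + k%:R) * q ^+ k)%:E)%E)]].
Proof.
move=> iter zs x.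
have [yhat yhat_u] := dual_minimizer A b hgs; have yhat_min := yhat_u.1.
have [xhat xhat_u] : exists xhat,
    unique (minimizer [set u | A *m u = yhat] f) xhat.
  have alphaf0 : 0 < alphaf by case: hf.
  have [u _ uE] := yhat_min.1.
  exact: (strong_minimizer alphaf0 (strongly_convex_subdifferentiable hf) uE).
have xhat_min := xhat_u.1; exists yhat, xhat.
have iterE k w : iter k w = run (gerk_next A b f gs alphaf Lg)
    (gerk_init b gs) (choice_pair J I) k w.
  by rewrite /iter; elim: k => //= k ->.
pose E F := @expectation_run _ _ _ _ _ P (gerk_weight p pt)
  (gerk_next A b f gs alphaf Lg) (gerk_init b gs) (choice_pair J I)
  (measurable_choice_pair hIJ) (choice_pair_law hIJ) ^~ F.
have zsE k : mean_sq_error P (zs k) (b - yhat) =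
    (gerk_mean A b f gs alphaf Lg p pt k
    (fun s => l2norm (gerk_zs s - (b - yhat)) ^+ 2))%:E.
  rewrite /mean_sq_error /zs; under eq_fun do rewrite iterE.
  by apply: E => s; exact: sqr_ge0.
have xE k : mean_sq_error P (x k) xhat =
    (gerk_mean A b f gs alphaf Lg p pt k
    (fun s => l2norm (gerk_x s - xhat) ^+ 2))%:E.
  rewrite /mean_sq_error /x; under eq_fun do rewrite iterE.
  by apply: E => s; exact: sqr_ge0.
have [q1 q101 [c1 c10 zrate]] := dual_rate f alphaf hAj hgs hLg hgsL hp hp1
  hpt hpt1 yhat_min.
(* The constants precede the hypotheses of the conditional rates, so that they
   are chosen by cases on these hypotheses. *)
have [c2 c20 xrate] : exists2 c, 0 < c & subdiff_linear_growth f ->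
    forall k, (0 < k)%N -> gerk_mean A b f gs alphaf Lg p pt k
      (fun s => l2norm (gerk_x s - xhat) ^+ 2) <= c / k%:R.
  have [fg|nfg] := pselect (subdiff_linear_growth f); last by exists 1.
  have [c c0 cP] := primal_rate_growth hAi hAj hgs hLg hgsL hf hp hp1
    hpt hpt1 yhat_min xhat_min fg.
  by exists c.
have [q3 q301 [c3 c30 xrateb]] : exists2 q, 0 < q < 1 & exists2 c, 0 < c &
    global_error_bound A f xhat yhat -> forall k,
    gerk_mean A b f gs alphaf Lg p pt k
      (fun s => l2norm (gerk_x s - xhat) ^+ 2) <= c * (1 + k%:R) * q ^+ k.
  have [eb|neb] := pselect (global_error_bound A f xhat yhat); last first.
    by exists (1 / 2); [lra|exists 1].
  have [q q01 [c c0 cP]] := primal_rate_error_bound hAi hAj hgs hLg hgsL hf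
    hp hp1 hpt hpt1 yhat_min xhat_min eb.
  by exists q => //; exists c.
split=> //.
- apply: (@cvg_in_expectation_squeeze _ _ _ _ _ _ _ (fun k => c1 * q1 ^+ k)).
    have /andP[q10 q11] := q101; rewrite -[0](mulr0 c1).
    apply: cvgM; first exact: cvg_cst.
    by apply: cvg_expr; rewrite ger0_norm// ltW.
  by near=> k; rewrite zsE lee_fin zrate.
- move=> fg.
  apply: (@cvg_in_expectation_squeeze _ _ _ _ _ _ _ (fun k => c2 / k%:R)).
    rewrite -[0](mulr0 c2); apply: cvgM; first exact: cvg_cst.
    by rewrite -cvg_shiftS; exact: cvg_harmonic.
  by exists 1%N => // k /= k0; rewrite xE lee_fin xrate.
have /andP[q10 q11] := q101; have /andP[q30 q31] := q301.
exists (Num.max q1 q3), (c1 + c2 + c3); split.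
- by rewrite lt_max q10 gt_max q11.
- by rewrite !addr_gt0.
- move=> k; rewrite zsE lee_fin (le_trans (zrate k))//.
  rewrite ler_pM ?exprn_ge0 ?(ltW q10) ?(ltW c10)//; first by lra.
  by rewrite lerXn2r ?nnegrE ?le_max ?(ltW q10) ?lexx.
- move=> fg; split=> [k k0|eb k].
    rewrite xE lee_fin (le_trans (xrate fg k k0))// ler_wpM2r ?invr_ge0//.
    by lra.
  rewrite xE lee_fin (le_trans (xrateb eb k))//.
  have k1 : 0 <= 1 + k%:R :> R by [].
  rewrite ler_pM ?exprn_ge0 ?mulr_ge0 ?(ltW q30) ?(ltW c30)//.
    by rewrite ler_wpM2r//; lra.
  by rewrite lerXn2r ?nnegrE ?le_max ?(ltW q30) ?lexx ?orbT.
Unshelve. all: by end_near. Qed.
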